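(* Let $\mathcal{CL}=\mathcal{L}\cup C$ be a real $\mathscr{M}$-arrangement consisting of a set $\mathcal{L}$ of $d\geq 3$ lines and one smooth conic $C$ (all members being defined over $\mathbb{R}$). Assume that $\mathcal{CL}$ has only ordinary singularities of multiplicity at most $4$. - If $d=2\ell$, then $\ell\leq 9$. In particular, there are no such arrangements for even $d\geq 20$. - If $d=2\ell+1$, then $\ell\leq 10$. In particular, there are no such arrangements for odd $d\geq 23$.
   Context: An arrangement of conics and lines is a finite set of pairwise distinct smooth conics and lines in $\mathbb{P}^2_{\mathbb{C}}$, identified with the reduced curve $\{f=0\}$ that is their union; with one conic and $d$ lines its degree is $d+2$. It is real if each of its lines and conics is given by an equation with real coefficients; singularities and the $\mathscr{M}$-condition are considered for the complex curve in $\mathbb{P}^2_{\mathbb{C}}$. A singular point is ordinary of multiplicity $r$ if exactly $r$ curves of the arrangement pass through it and their tangent lines there are pairwise distinct. For a reduced curve $C=\{f=0\}$, $J_f=\langle\partial_x f,\partial_y f,\partial_z f\rangle$ is the Jacobian ideal, and $\deg J_f$ is the degree of the scheme it defines, i.e. the total Tjurina number $\tau(C)=\sum_{p\in\mathrm{Sing}(C)}\tau_p$. (An ordinary point of multiplicity $r\le 4$ has $\tau_p=(r-1)^2$.) An arrangement of degree $e\geq 5$ with only ordinary singularities of multiplicity at most $4$ is an $\mathscr{M}$-arrangement (its union is an $\mathscr{M}$-curve) if it has at least one ordinary quadruple point and $$\deg J_f=\begin{cases}3m^2-3m+3 & \text{if } e=2m\geq 6,\\ 3m^2+1 & \text{if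 } e=2m+1\geq 5.\end{cases}$$ *)

(* Defs.v *)
From mathcomp Require Import all_boot all_order all_algebra.
From mathcomp Require Import fraction complex mpoly.

Set Implicit Arguments.
Unset Strict Implicit.
Unset Printing Implicit Defensive.

Import GRing.Theory.
Local Open Scope ring_scope.

(* Points of the projective plane are nonzero row vectors up to [proportional];
   likewise plane curves are nonzero homogeneous polynomials and lines tangent
   at a point are nonzero gradients, all up to [proportional]. *)
Definition proportional (C : fieldType) (V : lmodType C) (u v : V) : Prop :=
  exists2 c : C, c != 0 & v = c *: u.

Definition gradient (C : fieldType) (f : {mpoly C[3]}) (p : 'rV[C]_3) :
  'rV[C]_3 := \row_i (f^`M(i)).@[p 0].

Definition singular_point (C : fieldType) (f : {mpoly C[3]}) (p : 'rV[C]_3) :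
  Prop := [/\ p != 0, f.@[p 0] = 0 & gradient f p = 0].

Definition is_line (C : fieldType) (f : {mpoly C[3]}) : Prop :=
  f != 0 /\ f \is 1.-homog.

Definition is_smooth_conic (C : fieldType) (f : {mpoly C[3]}) : Prop :=
  [/\ f != 0, f \is 2.-homog & forall p, ~ singular_point f p].

Definition is_arrangement (C : fieldType) (I : finType)
    (F : I -> {mpoly C[3]}) : Prop :=
  (forall i, is_line (F i) \/ is_smooth_conic (F i)) /\
  (forall i j, i != j -> ~ proportional (F i) (F j)).

Definition union_curve (C : fieldType) (I : finType)
    (F : I -> {mpoly C[3]}) : {mpoly C[3]} := \prod_i F i.

(* [msize] is the total degree plus one. *)
Definition curve_degree (C : fieldType) (f : {mpoly C[3]}) : nat :=
  (msize f).-1.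

Definition lines_and_conic (C : fieldType) (d : nat)
    (L : 'I_d -> {mpoly C[3]}) (Q : {mpoly C[3]}) :
  option 'I_d -> {mpoly C[3]} := fun o => oapp L Q o.

Definition is_real_curve (R : rcfType) (f : {mpoly (complex R)[3]}) : Prop :=
  exists g : {mpoly R[3]}, proportional (map_mpoly (real_complex R) g) f.

Definition is_real_arrangement (R : rcfType) (I : finType)
    (F : I -> {mpoly (complex R)[3]}) : Prop :=
  forall i, is_real_curve (F i).

(* The members are smooth, so the tangent line of [F i] at [p] is the line
   whose coefficient vector is [gradient (F i) p]. *)
Definition ordinary_point (C : fieldType) (I : finType)
    (F : I -> {mpoly C[3]}) (r : nat) (p : 'rV[C]_3) : Prop :=
  [/\ singular_point (union_curve F) p,
      #|[set i | (F i).@[p 0] == 0]| = r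
    & forall i j, i != j -> (F i).@[p 0] = 0 -> (F j).@[p 0] = 0 ->
        ~ proportional (gradient (F i) p) (gradient (F j) p)].

Definition only_ordinary_singularities (C : fieldType) (I : finType)
    (F : I -> {mpoly C[3]}) (m : nat) : Prop :=
  forall p, singular_point (union_curve F) p ->
    exists2 r, (r <= m)%N & ordinary_point F r p.

Definition jacobian_ideal (C : fieldType) (f a : {mpoly C[3]}) : Prop :=
  exists h : 'I_3 -> {mpoly C[3]}, a = \sum_i h i * f^`M(i).

(* For a homogeneous ideal [J] of S = C[x,y,z], the degree-0 part J_(p) of the
   localization of [J] at [p], inside the fraction field of S. *)
Definition homog_localization (C : fieldType) (J : {mpoly C[3]} -> Prop)
    (p : 'rV[C]_3) (x : {fraction {mpoly C[3]}}) : Prop :=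
  exists (k : nat) (a b : {mpoly C[3]}),
    [/\ J a, a \is k.-homog, b \is k.-homog, b.@[p 0] != 0
      & x = FracField.tofrac a / FracField.tofrac b].

(* The local ring of the projective plane at [p]. *)
Definition local_ring (C : fieldType) (p : 'rV[C]_3) :=
  @homog_localization C (fun=> True) p.

(* The local ring at [p] of the scheme defined by J_f, namely
   S_(p) / (J_f)_(p), has dimension [n] over C: it has a basis of size [n]. *)
Definition has_tjurina_number (C : fieldType) (f : {mpoly C[3]})
    (p : 'rV[C]_3) (n : nat) : Prop :=
  exists e : 'I_n -> {fraction {mpoly C[3]}},
    (forall i, local_ring p (e i)) /\
    (forall x, local_ring p x ->
      exists! c : 'rV[C]_n,
        homog_localization (jacobian_ideal f) p
          (x - \sum_i FracField.tofrac (c 0 i)%:MP * e i)).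

(* deg J_f = [N]: the points [p i] represent each singular point exactly once
   and the local Tjurina numbers [t i] add up to [N]. *)
Definition has_jacobian_degree (C : fieldType) (f : {mpoly C[3]}) (N : nat) :
  Prop :=
  exists (k : nat) (p : 'I_k -> 'rV[C]_3) (t : 'I_k -> nat),
    [/\ forall i, singular_point f (p i),
        forall i j, i != j -> ~ proportional (p i) (p j),
        forall q, singular_point f q -> exists i, proportional (p i) q,
        forall i, has_tjurina_number f (p i) (t i)
      & N = (\sum_i t i)%N].

Definition M_degree (e : nat) : nat :=
  let m := e./2 in
  if odd e then (3 * m ^ 2 + 1)%N else (3 * m ^ 2 - 3 * m + 3)%N.

Definition is_M_arrangement (C : fieldType) (I : finType)
    (F : I -> {mpoly C[3]}) : Prop :=
  [/\ is_arrangement F,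
      (5 <= curve_degree (union_curve F))%N,
      only_ordinary_singularities F 4,
      exists p, ordinary_point F 4 p
    & has_jacobian_degree (union_curve F)
        (M_degree (curve_degree (union_curve F)))].

(* Main.v *)
Require Import Defs.
From mathcomp Require Import all_boot all_order all_algebra.
From mathcomp Require Import complex reals.
From mathcomp Require mpoly.
From mathcomp Require Import boolp fraction mpoly ring lra zify.

(** A singular point on [w] lines, and on the conic iff [e = 1], contributes at
most [(w + e - 1)^2] to the total Tjurina number: the Jacobian ideal contains
two elements whose leading forms are the partial derivatives of a product of
[w + e] distinct linear forms, and by Nakayama's lemma these bound the length
of the quotient.  Bezout bounds the sum of [w (w - 1)] by [d (d - 1)] and, since
the lines are transversal to the conic, the sum of [e w] by [2 d].  All points
on at least two lines are real, so the lines also satisfy Melchior's inequality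
[t_2 >= 3 + t_4]; it follows from counting the regions of a real arrangement of
planes through the origin of [R^3], each of which has at least three facets.
A linear combination of these inequalities is a quadratic inequality in [l]
whose solutions are [l <= 10]; for [d = 20] it is an equality, which forces all
points of the conic to be quadruple, and then [3] divides [2 d = 40]. *)

Set Implicit Arguments.
Unset Strict Implicit.
Unset Printing Implicit Defensive.

Import Order.TTheory GRing.Theory Num.Theory.
Local Open Scope ring_scope.

(** * Vectors in dimension three *)

Local Notation o0 := (ord0 : 'I_3).
Local Notation o1 := (Ordinal (isT : (1 < 3)%N)).
Local Notation o2 := (Ordinal (isT : (2 < 3)%N)).

(** The quadratic terms decide. The prescribed total Tjurina number grows like [3 d^2 / 4], that is,
    3/2 for each of the about [d^2 / 2] pairs of lines. A quadruple point of lines yields 9 for its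
    6 pairs, exactly this ratio, whereas a triple point yields 4 for 3 and a double point 1 for 1.
    Melchior's inequality demands more double than quadruple points, which lowers the average to at
    most [(9 + 1) / (6 + 1) = 10/7] per pair; the conic affects only terms linear in [d]. Hence [d]
    is bounded, and the weights 7 for the Tjurina number and 5 for ordered pairs of lines come from
    this ratio. Since the sum of the local Tjurina numbers is prescribed, upper bounds for them
    suffice: it is enough to span the local quotients, without proving independence. The local ring
    is a predicate on a fraction field, so its ideals and their powers are treated as predicates
    too. *)

Lemma big_ord3 (V : nmodType) (f : 'I_3 -> V) :
  \sum_(k < 3) f k = f o0 + f o1 + f o2.
Proof.
rewrite !big_ord_recl big_ord0 addr0 addrA.
by congr (_ + f _ + f _); apply: val_inj.
Qed.

Lemma ord3P (P : 'I_3 -> Prop) : P o0 -> P o1 -> P o2 -> forall k, P k.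
Proof.
move=> P0 P1 P2 [[|[|[|//]]] lt_k].
- by have -> : Ordinal lt_k = o0 by apply: val_inj.
- by have -> : Ordinal lt_k = o1 by apply: val_inj.
- by have -> : Ordinal lt_k = o2 by apply: val_inj.
Qed.

Definition dot (F : comPzRingType) (u v : 'rV[F]_3) : F := \sum_k u 0 k * v 0 k.

Definition cross (F : comPzRingType) (u v : 'rV[F]_3) : 'rV[F]_3 :=
  \row_k [:: u 0 o1 * v 0 o2 - u 0 o2 * v 0 o1;
             u 0 o2 * v 0 o0 - u 0 o0 * v 0 o2;
             u 0 o0 * v 0 o1 - u 0 o1 * v 0 o0]`_k.

Lemma dotE (F : comPzRingType) (u v : 'rV[F]_3) :
  dot u v = u 0 o0 * v 0 o0 + u 0 o1 * v 0 o1 + u 0 o2 * v 0 o2.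
Proof. exact: big_ord3. Qed.

Lemma crossE (F : comPzRingType) (u v : 'rV[F]_3) :
  (cross u v 0 o0 = u 0 o1 * v 0 o2 - u 0 o2 * v 0 o1) *
  (cross u v 0 o1 = u 0 o2 * v 0 o0 - u 0 o0 * v 0 o2) *
  (cross u v 0 o2 = u 0 o0 * v 0 o1 - u 0 o1 * v 0 o0).
Proof. by rewrite !mxE. Qed.

Lemma dotDr (F : comPzRingType) (u v w : 'rV[F]_3) :
  dot u (v + w) = dot u v + dot u w.
Proof. by rewrite !dotE !mxE; ring. Qed.

Lemma dotZr (F : comPzRingType) c (u v : 'rV[F]_3) : dot u (c *: v) = c * dot u v.
Proof. by rewrite !dotE !mxE; ring. Qed.

Lemma dotC (F : comPzRingType) (u v : 'rV[F]_3) : dot u v = dot v u.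
Proof. by rewrite !dotE; ring. Qed.

Lemma dot0r (F : comPzRingType) (u : 'rV[F]_3) : dot u 0 = 0.
Proof. by rewrite !dotE !mxE; ring. Qed.

Lemma dot_crossl (F : comPzRingType) (u v : 'rV[F]_3) : dot u (cross u v) = 0.
Proof. by rewrite !dotE !mxE /=; ring. Qed.

Lemma dot_crossr (F : comPzRingType) (u v : 'rV[F]_3) : dot v (cross u v) = 0.
Proof. by rewrite !dotE !mxE /=; ring. Qed.

Lemma crossC (F : comPzRingType) (u v : 'rV[F]_3) : cross u v = - cross v u.
Proof. by apply/rowP; apply: ord3P; rewrite !mxE /=; ring. Qed.

Lemma crossZr (F : comPzRingType) c (u v : 'rV[F]_3) :
  cross u (c *: v) = c *: cross u v.
Proof. by apply/rowP; apply: ord3P; rewrite !mxE /=; ring. Qed.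

Lemma cross_eq0 (F : fieldType) (w n : 'rV[F]_3) :
  n != 0 -> cross w n = 0 -> exists c, w = c *: n.
Proof.
move=> /rV0Pn[k nk] /rowP w_n.
suff par l : w 0 l * n 0 k = w 0 k * n 0 l.
  exists (w 0 k / n 0 k); apply/rowP => l; rewrite mxE.
  by apply: (mulIf nk); rewrite par mulrAC divfK.
have [] := (w_n o0, w_n o1, w_n o2); rewrite !crossE !mxE.
move=> [/subr0_eq e0 /subr0_eq e1] /subr0_eq e2.
by move: k l {nk}; apply: ord3P; apply: ord3P; rewrite ?e0 ?e1 ?e2.
Qed.

Lemma orthogonal_cross (F : fieldType) (u v w : 'rV[F]_3) :
  cross u v != 0 -> dot u w = 0 -> dot v w = 0 -> exists c, w = c *: cross u v.
Proof.
move=> n0 uw vw; apply: cross_eq0 => //.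
(* This is the expansion of the triple product [cross w (cross u v)]. *)
transitivity (dot v w *: u - dot u w *: v); last by rewrite uw vw !scale0r subr0.
by apply/rowP; apply: ord3P; rewrite !dotE !mxE /=; ring.
Qed.

(** * Melchior's inequality *)

Lemma uniform_radius (R : realDomainType) (T : finType) (A : {set T})
    (p : T -> R -> Prop) :
  (forall j, j \in A ->
     exists2 e, 0 < e & forall x, `|x| <= e -> p j x) ->
  exists2 e, 0 < e & forall x, `|x| <= e -> forall j, j \in A -> p j x.
Proof.
move=> pA; suff [e e0 pe] : exists2 e : R, 0 < e &
    forall x, `|x| <= e -> forall j, j \in enum A -> p j x.
  by exists e => // x xe j jA; apply: pe; rewrite ?mem_enum.
have {pA}: forall j, j \in enum A -> exists2 e, 0 < e & forall x, `|x| <= e -> p j x.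
  by move=> j; rewrite mem_enum; apply: pA.
elim: (enum A) => [|i s IHs] pA; first by exists 1.
have [j js|e e0 pe] := IHs; first by apply: pA; rewrite in_cons js orbT.
have [e' e'0 pe'] := pA i (mem_head _ _).
exists (Num.min e e'); first by rewrite lt_min e0.
move=> x; rewrite le_min => /andP[xe xe'] j; rewrite in_cons.
by case/orP=> [/eqP->|/pe]; [exact: pe' | exact].
Qed.

Section Melchior.

Variables (R : realFieldType) (n : nat) (a : 'I_n -> 'rV[R]_3).
Hypothesis a_cross : forall i j, i != j -> cross (a i) (a j) != 0.

Implicit Types (Z A P S : {set 'I_n}) (v w : 'rV[R]_3).

(* Sign vectors on [A] are encoded by their set [P] of positive indices; [Z]
   restricts them to the subspace where the forms in [Z] vanish. *)
Definition sgn_in P (j : 'I_n) : R := (-1) ^+ (j \notin P).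

Definition realizes Z A P v : Prop :=
  (forall i, i \in Z -> dot (a i) v = 0) /\
  (forall j, j \in A -> 0 < sgn_in P j * dot (a j) v).

Definition regions Z A : {set {set 'I_n}} :=
  [set P in powerset A | `[< exists v, realizes Z A P v >]].

Lemma regionsP Z A P :
  reflect (P \subset A /\ exists v, realizes Z A P v) (P \in regions Z A).
Proof.
rewrite inE ?powersetE; apply: (iffP andP) => [[-> /asboolP]//|[-> ?]].
by split=> //; apply/asboolP.
Qed.

Lemma eq_realizes Z A P P' v :
  {in A, P =i P'} -> realizes Z A P v -> realizes Z A P' v.
Proof.
by move=> PP' [vZ vA]; split=> // j jA; rewrite /sgn_in -PP' //; apply: vA.
Qed.

(** Strict inequalities survive a small displacement, and the equations survive one inside their
    solution space. *)
Lemma perturb Z A P v w :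
  realizes Z A P v -> (forall i, i \in Z -> dot (a i) w = 0) ->
  exists2 e, 0 < e & forall x, `|x| <= e -> realizes Z A P (v + x *: w).
Proof.
move=> [vZ vA] wZ.
have [j jA|e e0 he] := @uniform_radius R _ A
    (fun j x => 0 < sgn_in P j * dot (a j) (v + x *: w)).
  set b := sgn_in P j * dot (a j) w.
  have := vA j jA; set c := sgn_in P j * _ => c0.
  have b1 : 0 < `|b| + 1 by rewrite ltr_wpDl.
  exists (c / (`|b| + 1) / 2%:R); first by rewrite !divr_gt0 ?ltr0n.
  move=> x xe; rewrite dotDr dotZr mulrDr mulrCA -/b -/c.
  have: `|x * b| < c.
    move: xe; rewrite !ler_pdivlMr ?ltr0n // (normrM x b).
    have := normr_ge0 x; lra.
  by rewrite ltr_norml => /andP[]; lra.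
exists e => // x xe; split; last by move=> j; apply: he.
by move=> i iZ; rewrite dotDr dotZr vZ // wZ // mulr0 addr0.
Qed.

Lemma regions0 Z : regions Z set0 = [set set0].
Proof.
apply/setP => P; rewrite inE ?powersetE subset0 inE andb_idr // => _.
apply/asboolP; exists 0; split=> [i _|j]; last by rewrite inE.
by rewrite dot0r.
Qed.

(* Deletion-restriction: a region of [A] is cut in two by the form [k] exactly
   when it meets the hyperplane where [k] vanishes. *)
Lemma card_regionsU1 Z A k w :
  k \notin A -> (forall i, i \in Z -> dot (a i) w = 0) -> dot (a k) w != 0 ->
  #|regions Z (k |: A)| = (#|regions Z A| + #|regions (k |: Z) A|)%N.
Proof.
move=> kA wZ kw.
(* [pos] and [neg] collect the regions of [A] with a point strictly on the respective side of the
   form [k]. Their sizes add up to the new count, their union is [regions Z A] and their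
   intersection is the restriction, so inclusion-exclusion concludes. *)
pose pos := [set P in powerset A |
  `[< exists2 v, realizes Z A P v & 0 < dot (a k) v >]].
pose neg := [set P in powerset A |
  `[< exists2 v, realizes Z A P v & dot (a k) v < 0 >]].
have posN P : P \in pos -> k \notin P.
  by rewrite inE ?powersetE => /andP[/subsetP PA _]; apply: contra kA; apply: PA.
have negN P : P \in neg -> k \notin P.
  by rewrite inE ?powersetE => /andP[/subsetP PA _]; apply: contra kA; apply: PA.
have kjA j : j \in A -> (j == k) = false.
  by move=> jA; apply: contraNF kA => /eqP <-.
have -> : regions Z (k |: A) = neg :|: [set k |: P | P in pos].
  apply/setP => P; rewrite !inE ?powersetE.
  apply/andP/orP => [[PA /asboolP[v [vZ vA]]]|].
    have := vA k (setU11 _ _); rewrite /sgn_in.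
    have [kP|kP] := boolP (k \in P); rewrite ?mul1r ?mulN1r ?oppr_gt0 => sk.
      right; apply/imsetP; exists (P :\ k); last by rewrite setD1K.
      rewrite inE ?powersetE subDset PA /=; apply/asboolP; exists v => //.
      apply: (@eq_realizes _ _ P); first by move=> j jA; rewrite !inE kjA.
      by split=> // j jA; apply: vA; rewrite !inE jA orbT.
    left; apply/andP; split.
      apply/subsetP => j jP; have := subsetP PA j jP; rewrite !inE.
      by case/orP=> // /eqP jk; rewrite jk (negPf kP) in jP.
    apply/asboolP; exists v => //; split=> // j jA.
    by apply: vA; rewrite !inE jA orbT.
  case=> [/andP[PA /asboolP[v [vZ vA] vk]]|/imsetP[P' P'pos ->]].
    split; first by rewrite subsetU // PA orbT.
    apply/asboolP; exists v; split=> // j; rewrite !inE.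
    case/orP=> [/eqP->|]; last exact: vA.
    have kP : k \notin P by apply: contra kA; apply: (subsetP PA).
    by rewrite /sgn_in kP mulN1r oppr_gt0.
  have kP' := posN _ P'pos; move: P'pos.
  rewrite inE ?powersetE => /andP[PA /asboolP[v vA vk]].
  split; first exact: setUS.
  apply/asboolP; exists v; split=> [|j]; first by case: vA.
  rewrite !inE => /orP[/eqP->|jA]; first by rewrite /sgn_in setU11 mul1r.
  have: realizes Z A (k |: P') v.
    by apply: eq_realizes vA => i iA; rewrite !inE kjA.
  by case=> _; apply.
have -> : regions Z A = neg :|: pos.
  apply/setP => P; rewrite !inE ?powersetE -andb_orr; congr andb.
  apply/asboolP/orP => [[v vA]|]; last first.
    by case=> /asboolP[v ? _]; exists v.
  have [vk|vk|vk] := ltgtP (dot (a k) v) 0; last 1 first.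
  - have [e e0 he] := perturb vA wZ.
    have [kw0|kw0] := ltP 0 (dot (a k) w).
      right; apply/asboolP; exists (v + e *: w).
        by apply: he; rewrite ger0_norm // ltW.
      by rewrite dotDr dotZr vk add0r mulr_gt0.
    left; apply/asboolP; exists (v + e *: w).
      by apply: he; rewrite ger0_norm // ltW.
    by rewrite dotDr dotZr vk add0r pmulr_rlt0 // lt_neqAle kw.
  - by left; apply/asboolP; exists v.
  - by right; apply/asboolP; exists v.
have -> : regions (k |: Z) A = neg :&: pos.
  apply/setP => P; rewrite !inE ?powersetE; case: (P \subset A) => //=.
  apply/asboolP/andP => [[v [vZ vA]]|].
    have vk : dot (a k) v = 0 by apply: vZ; rewrite setU11.
    have vA' : realizes Z A P v.
      by split=> // i iZ; apply: vZ; rewrite !inE iZ orbT.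
    have [e e0 he] := perturb vA' wZ.
    have vp : realizes Z A P (v + e *: w).
      by apply: he; rewrite ger0_norm // ltW.
    have vm : realizes Z A P (v + (- e) *: w).
      by apply: he; rewrite normrN ger0_norm // ltW.
    have [kw0|kw0] := ltP 0 (dot (a k) w).
      split; apply/asboolP; [exists (v + - e *: w)|exists (v + e *: w)] => //;
        rewrite dotDr dotZr vk add0r ?mulr_gt0 //.
      by rewrite mulNr oppr_lt0 mulr_gt0.
    have {}kw0 : dot (a k) w < 0 by rewrite lt_neqAle kw.
    split; apply/asboolP; [exists (v + e *: w)|exists (v + - e *: w)] => //;
      rewrite dotDr dotZr vk add0r.
      by rewrite pmulr_rlt0.
    by rewrite nmulr_rgt0 // oppr_lt0.
  case=> /asboolP[v [vZ vA] vk] /asboolP[u [uZ uA] uk].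
  (* Two points on opposite sides of the plane of [k] have a positive combination lying on it. *)
  exists (dot (a k) u *: v + - dot (a k) v *: u); split=> [i|j jA].
    rewrite !inE dotDr !dotZr => /orP[/eqP->|iZ]; first by ring.
    by rewrite (vZ i iZ) (uZ i iZ) !mulr0 addr0.
  rewrite dotDr !dotZr mulrDr addr_gt0 // mulrCA mulr_gt0 ?oppr_gt0 //.
    exact: vA.
  exact: uA.
rewrite cardsUI cardsU.
have -> : neg :&: [set k |: P | P in pos] = set0.
  apply/setP => P; rewrite !in_set0; apply/negP; rewrite in_setI.
  by case/andP=> /negN + /imsetP[P' _ PP']; rewrite PP' setU11.
rewrite cards0 subn0 card_in_imset // => P P' /posN kP /posN kP' PP'.
by rewrite -(setU1K kP) PP' setU1K.
Qed.

(** * Vertices of the line arrangement and the number of regions *)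

Lemma sgn_in_gt0 P j (y : R) :
  (0 < sgn_in P j * y) = (y != 0) && ((j \in P) == (0 < y)).
Proof.
rewrite /sgn_in; case: (j \in P); rewrite ?mul1r ?mulN1r ?oppr_gt0 /=;
  by case: ltgtP.
Qed.

(** A vertex of the projective arrangement is encoded by the set of all lines through it, so that
    its multiplicity is a cardinality; [cross (a i) (a j)] is the point where the lines [i] and [j]
    meet. *)
Definition flat (i j : 'I_n) : {set 'I_n} :=
  [set k | dot (a k) (cross (a i) (a j)) == 0].

Definition flats : {set {set 'I_n}} :=
  [set flat p.1 p.2 | p in [pred p : 'I_n * 'I_n | p.1 != p.2]].

Lemma flat_in_flats i j : i != j -> flat i j \in flats.
Proof. by move=> ij; apply/imsetP; exists (i, j). Qed.

Lemma mem_flatl i j : i \in flat i j.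
Proof. by rewrite inE dot_crossl. Qed.

Lemma mem_flatr i j : j \in flat i j.
Proof. by rewrite inE dot_crossr. Qed.

Lemma flats_eq S i j : S \in flats -> i \in S -> j \in S -> i != j -> S = flat i j.
Proof.
case/imsetP=> [[i0 j0] /a_cross /= c0 ->]; rewrite !inE => /eqP ic /eqP jc ij.
have [x cx] := orthogonal_cross (a_cross ij) ic jc.
have x0 : x != 0 by apply: contraNneq c0 => x0; rewrite cx x0 scale0r.
by apply/setP => k; rewrite !inE cx dotZr mulf_eq0 (negPf x0).
Qed.

Lemma card_flat_gt1 S : S \in flats -> (1 < #|S|)%N.
Proof.
case/imsetP=> [[i j] /= ij ->]; apply/card_gt1P.
by exists i, j; rewrite mem_flatl mem_flatr.
Qed.

(** On the line [a i = a k = 0] of the space a form of the flat vanishes identically, hence has no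
    strict sign. *)
Lemma card_regions2_meet i k A :
  i != k -> flat i k :&: A != set0 -> #|regions (k |: [set i]) A| = 0%N.
Proof.
move=> ik /set0Pn[j]; rewrite !inE => /andP[/eqP jc jA].
apply/eqP; rewrite cards_eq0; apply/eqP/setP => P; rewrite in_set0.
apply/negP => /regionsP[_ [v [vZ vA]]].
have [||x vx] := orthogonal_cross (a_cross ik) (_ : dot _ v = 0) (_ : dot _ v = 0).
- by apply: vZ; rewrite !inE eqxx orbT.
- by apply: vZ; rewrite !inE eqxx.
by have := vA j jA; rewrite vx dotZr jc !mulr0 ltxx.
Qed.

(** Without the origin, the line [a i = a k = 0] consists of two opposite rays, and any form of [A]
    tells their sign vectors apart. *)
Lemma card_regions2_disjoint i k A :
  i != k -> A != set0 -> flat i k :&: A = set0 ->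
  #|regions (k |: [set i]) A| = 2%N.
Proof.
move=> ik A0 dA; set c := cross (a i) (a k).
have jc j : j \in A -> dot (a j) c != 0.
  by move=> jA; have /setP/(_ j) := dA; rewrite !inE jA andbT => ->.
pose pos := [set j in A | 0 < dot (a j) c].
have -> : regions (k |: [set i]) A = [set pos; A :\: pos].
  apply/setP => P; rewrite in_set2; apply/idP/idP.
    move/regionsP=> [PA [v [vZ vA]]].
    have [||x vx] := orthogonal_cross (a_cross ik) (_ : dot _ v = 0) (_ : dot _ v = 0).
    - by apply: vZ; rewrite !inE eqxx orbT.
    - by apply: vZ; rewrite !inE eqxx.
    have jP j : j \in P = (j \in A) && (0 < x * dot (a j) c).
      have [jA|jA] /= := boolP (j \in A); last first.
        by apply: contraNF jA => /(subsetP PA).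
      by have := vA j jA; rewrite vx dotZr sgn_in_gt0 => /andP[_ /eqP].
    have [x0|x0|x0] := ltgtP x 0.
    - apply/orP; right; apply/eqP/setP => j; rewrite jP !inE.
      have [jA|//] /= := boolP (j \in A).
      by rewrite nmulr_rgt0 // andbT -leNgt le_eqVlt (negPf (jc j jA)).
    - apply/orP; left; apply/eqP/setP => j.
      by rewrite jP !inE pmulr_rgt0.
    have /set0Pn[j jA] := A0.
    by have := vA j jA; rewrite vx dotZr x0 mul0r mulr0 ltxx.
  case/orP=> /eqP->; apply/regionsP.
    split; first by apply/subsetP => j; rewrite inE => /andP[].
    exists c; split=> [j|j jA].
      by rewrite !inE => /orP[] /eqP->; rewrite ?dot_crossr ?dot_crossl.
    by rewrite sgn_in_gt0 jc // !inE jA /= eqxx.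
  split; first exact: subsetDl.
  exists (-1 *: c); split=> [j|j jA].
    rewrite !inE dotZr => /orP[] /eqP->;
      by rewrite ?dot_crossr ?dot_crossl mulr0.
  rewrite sgn_in_gt0 dotZr mulN1r oppr_eq0 jc // !inE jA /= andbT oppr_gt0.
  by rewrite -leNgt le_eqVlt (negPf (jc j jA)) /= eqxx.
rewrite cards2; case: eqP => // /setP posE.
have /set0Pn[j jA] := A0; have := posE j.
by rewrite !inE jA /=; case: (0 < _).
Qed.

Definition flats_on i A : {set {set 'I_n}} :=
  [set S in flats | (i \in S) && (S :&: A != set0)].

Lemma exists_dot_neq0 i k : i != k -> exists2 w, dot (a i) w = 0 & dot (a k) w != 0.
Proof.
(* Up to a positive factor this is the component of [a k] orthogonal to [a i]; its product with
   [a k] is the sum of squares [dot c c] for [c = cross (a k) (a i)], nonzero over an ordered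
   field. *)
move=> ik; exists (cross (a i) (cross (a k) (a i))); first exact: dot_crossl.
have: cross (a k) (a i) != 0 by rewrite a_cross // eq_sym.
set c := cross (a k) (a i) => c0.
have -> : dot (a k) (cross (a i) c) = dot c c.
  by rewrite !dotE !crossE; ring.
rewrite dotE -!expr2; apply: contraNneq c0 => /eqP.
rewrite !paddr_eq0 ?addr_ge0 ?sqr_ge0 // !sqrf_eq0.
by move=> /andP[/andP[/eqP c0 /eqP c1] /eqP c2]; apply/eqP/rowP; apply: ord3P;
  rewrite ?c0 ?c1 ?c2 mxE.
Qed.

(** Inside the plane [a i = 0] the forms of [A] cut out lines through the origin, one for each
    vertex, and [m > 0] such lines bound [2 m] sectors. In the induction a new form adds two sectors
    if its vertex is new and none otherwise. *)
Lemma card_regions1 i A : i \notin A -> A != set0 ->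
  #|regions [set i] A| = (2 * #|flats_on i A|)%N.
Proof.
elim: {A}#|A| {-2}A (erefl #|A|) => [|m IH] B cB.
  by move/eqP: cB; rewrite cards_eq0 => ->.
have /set0Pn[k kB] : B != set0 by rewrite -cards_eq0 cB.
rewrite -(setD1K kB); have kA : k \notin B :\ k by rewrite setD11.
have {}IH := IH (B :\ k); move: cB; rewrite (cardsD1 k) kB => -[/IH].
move: (B :\ k) kA => A kA {B kB}IH.
rewrite !inE negb_or => /andP[ik iA] _.
have [w iw kw] := exists_dot_neq0 ik.
rewrite (card_regionsU1 (w := w)) //; last by move=> j; rewrite inE => /eqP->.
have [A0|A0] := eqVneq A set0.
  rewrite A0 !regions0 !cards1; suff -> : flats_on i (k |: set0) = [set flat i k].
    by rewrite cards1.
  apply/setP => S; rewrite setU0 !inE.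
  apply/andP/eqP => [[Sf /andP[iS /set0Pn[j]]]|->].
    by rewrite !inE => /andP[jS /eqP jk]; apply: flats_eq; rewrite // -jk.
  rewrite flat_in_flats //; split=> //; apply/andP; split; first exact: mem_flatl.
  apply/set0Pn; exists k.
  by rewrite in_setI mem_flatr inE eqxx.
rewrite IH //; have [dA|mA] := eqVneq (flat i k :&: A) set0.
  rewrite card_regions2_disjoint //.
  suff -> : flats_on i (k |: A) = flat i k |: flats_on i A.
    by rewrite cardsU1 [_ \in flats_on _ _]inE dA eqxx !andbF /=; lia.
  apply/setP => S; rewrite in_setU1 [in LHS]inE [S \in flats_on i A]inE.
  have [->|Sf] /= := eqVneq S (flat i k).
    rewrite flat_in_flats // mem_flatl; apply/set0Pn; exists k.
    by rewrite in_setI mem_flatr setU11.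
  apply: andb_id2l => Sfl.
  apply: andb_id2l => iS; apply/idP/idP => /set0Pn[j].
    rewrite in_setI in_setU1 => /andP[jS /orP[/eqP jk|jA]].
      by rewrite (@flats_eq S i k) ?eqxx // -?jk // in Sf.
    by apply/set0Pn; exists j; rewrite in_setI jS.
  rewrite in_setI => /andP[jS jA]; apply/set0Pn; exists j.
  by rewrite in_setI in_setU1 jS jA orbT.
rewrite (card_regions2_meet ik mA) // addn0; congr (2 * _)%N.
suff -> : flats_on i (k |: A) = flats_on i A by [].
apply/setP => S; rewrite [in LHS]inE [RHS]inE.
apply: andb_id2l => Sf; apply: andb_id2l => iS; apply/idP/idP => /set0Pn[j].
  rewrite in_setI in_setU1 => /andP[jS /orP[/eqP jk|jA]].
    by rewrite (@flats_eq S i k) // -jk.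
  by apply/set0Pn; exists j; rewrite in_setI jS.
rewrite in_setI => /andP[jS jA]; apply/set0Pn; exists j.
by rewrite in_setI in_setU1 jS jA orbT.
Qed.

(** The forms are added in the order of their indices, and each new plane splits one region per
    sector into which it is cut. The formula starts at [m = 1]: the first plane is uncut and turns
    one region into two, whence the summand 2. *)
Lemma card_regions_prefix m : (1 < n)%N -> (0 < m <= n)%N ->
  #|regions set0 [set j : 'I_n | (j < m)%N]|
    = (2 + 2 * \sum_(i < n | (i < m)%N) #|flats_on i [set j : 'I_n | (j < i)%N]|)%N.
Proof.
move=> n1; elim: m => // m IH /andP[_ mn].
pose k := Ordinal mn.
have kA : k \notin [set j : 'I_n | (j < m)%N] by rewrite inE ltnn.
have -> : [set j : 'I_n | (j < m.+1)%N] = k |: [set j : 'I_n | (j < m)%N].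
  by apply/setP => j; rewrite !inE ltnS leq_eqVlt.
have [i ik] : exists i, i != k.
  have [m0|m0] := posnP m; last by exists (Ordinal (ltnW n1)); rewrite -val_eqE /= neq_ltn m0.
  by exists (Ordinal n1); rewrite -val_eqE /= m0.
have [w _ kw] := exists_dot_neq0 ik.
rewrite (card_regionsU1 (w := w)) // => [|j]; last by rewrite inE.
rewrite setU0 (bigD1 k) //=.
have -> : \sum_(j < n | (j < m.+1)%N && (j != k)) #|flats_on j [set j0 : 'I_n | (j0 < j)%N]|
   = \sum_(j < n | (j < m)%N) #|flats_on j [set j0 : 'I_n | (j0 < j)%N]|.
  by apply: eq_bigl => j; rewrite ltnS -val_eqE /= [RHS]ltn_neqAle andbC.
have [m0|m0] := posnP m.
  have -> : [set j : 'I_n | (j < m)%N] = set0 by apply/setP=> j; rewrite !inE m0.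
  rewrite !regions0 !cards1 big_pred0 => [|j]; last by rewrite m0.
  suff -> : flats_on k set0 = set0 by rewrite cards0.
  by apply/setP => S; rewrite !inE setI0 eqxx !andbF.
rewrite IH ?m0 ?(ltnW mn) // card_regions1 //.
  by rewrite -addnA -mulnDr [X in (2 * X)%N]addnC.
by apply/set0Pn; exists (Ordinal (ltnW n1)); rewrite inE.
Qed.

(** A flat [S] is counted by each of its elements except the least, for which [S] contains no
    earlier line. *)
Lemma sum_flats_on_prefix :
  (\sum_(i < n) #|flats_on i [set j : 'I_n | (j < i)%N]| =
   \sum_(S in flats) #|S|.-1)%N.
Proof.
transitivity (\sum_(i < n) \sum_(S in flats)
    ((i \in S) && (S :&: [set j : 'I_n | (j < i)%N] != set0)))%N.
  by apply: eq_bigr => i _; rewrite -sum1dep_card big_mkcondr.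
rewrite exchange_big; apply: eq_bigr => S Sf /=.
have [i0 i0S _] : exists2 i, i \in S & true.
  have /card_gt0P[i iS] : (0 < #|S|)%N by apply: ltnW; apply: card_flat_gt1.
  by exists i.
case: (arg_minnP (fun i : 'I_n => i : nat) i0S) => k kS' k_min; have kS : k \in S by [].
rewrite -sum1_card (bigD1 k kS) /= [RHS]big_mkcond; apply: eq_bigr => i _.
set b := (X in nat_of_bool X); suff -> : b = (i \in S) && (i != k) by case: ifP.
apply: andb_id2l => iS; apply/set0Pn/idP.
  case=> j; rewrite !inE => /andP[jS ji]; apply: contraTneq ji => ->.
  by rewrite -leqNgt; apply: k_min.
move=> ik; exists k; rewrite !inE kS /= ltn_neqAle k_min // andbT.
by rewrite eq_sym.
Qed.

Lemma card_regions_all : (1 < n)%N ->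
  #|regions set0 setT| = (2 + 2 * \sum_(S in flats) #|S|.-1)%N.
Proof.
move=> n1; rewrite -sum_flats_on_prefix.
have -> : [set: 'I_n] = [set j : 'I_n | (j < n)%N].
  by apply/setP => j; rewrite !inE ltn_ord.
rewrite card_regions_prefix ?leqnn ?(ltnW n1) //.
by congr (2 + 2 * _)%N; apply: eq_bigl => j; rewrite ltn_ord.
Qed.

(** * Facets of the regions when the lines are not concurrent *)

Lemma orthogonal_to_two (D : {set 'I_n}) : (#|D| <= 2)%N ->
  exists2 w, w != 0 & forall j, j \in D -> dot (a j) w = 0.
Proof.
move=> D2; pose M := \matrix_(l < 3, k < #|D|) a (enum_val k) 0 l.
have: kermx M != 0.
  rewrite -mxrank_eq0 mxrank_ker subn_eq0 -ltnNge ltnS.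
  by apply: leq_trans (rank_leq_col M) D2.
case/rowV0Pn=> w /sub_kermxP/rowP wM w0; exists w => // j jD.
have := wM (enum_rank_in jD j); rewrite !mxE => <-.
by apply: eq_bigr => l _; rewrite mxE enum_rankK_in // mulrC.
Qed.

Hypothesis a_rank : forall w, (forall j, dot (a j) w = 0) -> w = 0.

(** The form [i] bounds the region [P] when the signs that [P] prescribes to the other forms are
    realized on the plane [a i = 0]; removing [i] turns [P] into a sign vector on the complement. *)
Definition facets P : {set 'I_n} := [set i | P :\ i \in regions [set i] [set~ i]].

(* An inclusion-minimal set [D] of forms cutting out the region consists of
   facets, and two forms cannot cut out a region since it contains no line. *)
Lemma card_facets P : P \in regions set0 setT -> (3 <= #|facets P|)%N.
Proof.
case/regionsP=> _ [v0 [_ v0P]].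
pose s j v := sgn_in P j * dot (a j) v.
have sD j u v x : s j (u + x *: v) = s j u + x * s j v.
  by rewrite /s dotDr dotZr; ring.
have {}v0P j : 0 < s j v0 by apply: v0P; rewrite inE.
pose cut (D : {set 'I_n}) := forall v, (forall j, j \in D -> 0 < s j v) -> forall j, 0 < s j v.
have cutT : `[< cut setT >] by apply/asboolP => v vT j; apply: vT; rewrite inE.
have [D /minsetP[/asboolP cutD D_min] _] :=
  @minset_exists _ (fun D => `[< cut D >]) _ cutT.
apply: (@leq_trans #|D|); last first.
  apply/subset_leq_card/subsetP => i iD; rewrite inE.
  (* Such a [w] lies in the closure of the region: every positive displacement along [v0] enters the
     region, whereas a form [j] negative at [w] would vanish at the displacement chosen below. *)
  have sD_ge0 w : s i w = 0 -> (forall j, j \in D :\ i -> 0 < s j w) ->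
      forall j, 0 <= s j w.
    move=> wi wD j; rewrite leNgt; apply/negP => wj.
    have x0 : 0 < - s j w / s j v0 by rewrite divr_gt0 // oppr_gt0.
    suff /cutD/(_ j) : forall k, k \in D -> 0 < s k (w + (- s j w / s j v0) *: v0).
      by rewrite sD divfK ?gt_eqF // subrr ltxx.
    move=> k kD; rewrite sD; have [->|ki] := eqVneq k i; first by rewrite wi add0r mulr_gt0.
    by apply: addr_gt0; [apply: wD; rewrite !inE ki | apply: mulr_gt0].
  (* Minimality of [D]: without the form [i], some [u] outside the region satisfies all remaining
     conditions. *)
  have [u uD ui] : exists2 u, forall j, j \in D :\ i -> 0 < s j u & s i u <= 0.
    apply: contrapT => nex.
    have cutDi : `[< cut (D :\ i) >].
      apply/asboolP => u uD; apply: cutD => j jD.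
      have [->|ji] := eqVneq j i; last by apply: uD; rewrite !inE ji.
      by rewrite ltNge; apply/negP => ui; apply: nex; exists u.
    have /setP/(_ i) := D_min _ cutDi (subsetDl _ _).
    by rewrite !inE iD eqxx.
  pose w := s i v0 *: u + (- s i u) *: v0.
  have sw j : s j w = s i v0 * s j u - s i u * s j v0.
    by rewrite sD /s dotZr; ring.
  have wi : s i w = 0 by rewrite sw mulrC subrr.
  have wD j : j \in D :\ i -> 0 < s j w.
    move=> jD; rewrite sw -mulNr; apply: ltr_pwDl.
      by apply: mulr_gt0 => //; apply: uD.
    by apply: mulr_ge0; rewrite ?oppr_ge0 // ltW.
  have iw : dot (a i) w = 0.
    move/eqP: wi; rewrite /s mulf_eq0 /sgn_in signr_eq0 /=.
    by move/eqP.
  apply/regionsP; split; first by apply/subsetP => j; rewrite !inE => /andP[].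
  exists w; apply: (@eq_realizes _ _ P).
    by move=> j; rewrite !inE => ->.
  split=> j; rewrite !inE; first by move/eqP->.
  move=> ji; rewrite -/(s j w).
  rewrite lt_neqAle sD_ge0 // andbT eq_sym; apply/eqP => wj.
  (* If another form [j] vanished at [w], a small move inside the plane of [i] would make it
     negative. *)
  have [|y iy jy] := @exists_dot_neq0 i j; first by rewrite eq_sym.
  have wR : realizes [set i] (D :\ i) P w.
    by split=> k; [rewrite inE => /eqP-> | apply: wD].
  have yZ k : k \in [set i] -> dot (a k) y = 0 by rewrite inE => /eqP->.
  have [e e0 he] := perturb wR yZ.
  have sy : s j y != 0 by rewrite mulf_neq0 // signr_eq0.
  have [x xe xy] : exists2 x, `|x| <= e & x * s j y < 0.
    have [sy0|sy0] := ltP 0 (s j y).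
      exists (- e); first by rewrite normrN ger0_norm // ltW.
      by rewrite mulNr oppr_lt0 mulr_gt0.
    exists e; first by rewrite ger0_norm // ltW.
    by rewrite pmulr_rlt0 // lt_neqAle sy.
  have [_ heD] := he x xe.
  have := @sD_ge0 (w + x *: y) _ heD j; rewrite (sD i w) (sD j w) wj add0r leNgt xy wi add0r.
  by rewrite /s iy !mulr0 => /(_ erefl).
rewrite ltnNge; apply/negP => /orthogonal_to_two[w /eqP w0 wD].
apply: w0; apply: a_rank => j; apply/eqP; apply: contraT => wj.
have sw : s j w != 0 by rewrite mulf_neq0 // signr_eq0.
suff /cutD/(_ j) : forall k, k \in D -> 0 < s k (v0 + (- s j v0 / s j w) *: w).
  by rewrite sD divfK // subrr ltxx.
by move=> k kD; rewrite sD /s (wD k kD) !mulr0 addr0; apply: v0P.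
Qed.

(* Count incidences between regions and facets: every region has at least three
   facets, and the edges on the line [i] bound two regions each. *)
Theorem melchior : (1 < n)%N ->
  (\sum_(S in flats) #|S| + 3 <= 3 * #|flats|)%N.
Proof.
move=> n1.
have edges i : #|regions [set i] [set~ i]| = (2 * #|[set S in flats | i \in S]|)%N.
  rewrite card_regions1 ?inE ?eqxx //.
    congr (2 * #|pred_of_set _|)%N; apply/setP => S; rewrite !inE.
    apply: andb_id2l => Sf; rewrite andb_idr // => iS.
    have /card_gt1P[j [k [jS kS jk]]] := card_flat_gt1 Sf.
    apply/set0Pn; have [ji|ji] := eqVneq j i.
      by exists k; rewrite !inE kS -ji eq_sym.
    by exists j; rewrite !inE jS ji.
  rewrite -card_gt0 cardsC1 card_ord; lia.
have incid : (\sum_(P in regions set0 setT) #|facets P| <=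
              \sum_(i < n) 2 * #|regions [set i] [set~ i]|)%N.
  under eq_bigr do rewrite -sum1_card big_mkcond /=.
  rewrite exchange_big; apply: leq_sum => i _; rewrite -big_mkcondr sum1dep_card.
  rewrite -[X in (_ <= 2 * X)%N]cardsE -card_bool -cardsT -cardsX.
  rewrite -(@card_in_imset _ _ (fun P => (i \in P, P :\ i))); last first.
    move=> P P' _ _ [iP PP']; apply/setP => j.
    have [->//|ji] := eqVneq j i.
    by have /setP/(_ j) := PP'; rewrite !inE ji.
  apply/subset_leq_card/subsetP => x /imsetP[P]; rewrite !inE => /andP[_ iP] ->.
  by rewrite /= iP.
have: (\sum_(P in regions set0 setT) 3 <= \sum_(P in regions set0 setT) #|facets P|)%N.
  by apply: leq_sum => P; apply: card_facets.
move/leq_trans/(_ incid).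
have -> : (\sum_(i < n) 2 * #|regions [set i] [set~ i]| = 4 * \sum_(S in flats) #|S|)%N.
  rewrite big_distrr /=.
  under eq_bigr do rewrite edges mulnA -sum1dep_card big_mkcondr big_distrr /=.
  rewrite exchange_big; apply: eq_bigr => S _; rewrite -big_distrr /=.
  by rewrite -big_mkcond sum1_card.
(* With [sigma] the sum of the [#|S|] and [f] the number of flats, the count reads
   [3 (2 + 2 (sigma - f)) <= 4 sigma]. *)
rewrite sum_nat_const card_regions_all //.
have -> : (\sum_(S in flats) #|S| = \sum_(S in flats) #|S|.-1 + #|flats|)%N.
  rewrite -sum1_card -big_split; apply: eq_bigr => S /card_flat_gt1 /=; lia.
lia.
Qed.

End Melchior.

(** * Leading forms in a local ring *)

Section LocalAlgebra.

Variables (K E : fieldType) (cst : {rmorphism K -> E}).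
Variables (O J : E -> Prop) (s t : E).

(** The power [m^j] of the maximal ideal [m] of the local ring [O], generated by the parameters [s]
    and [t]. Iterated combinations of [s] and [t] replace sums over monomials, so that proofs go by
    induction on [j]. *)
Fixpoint mpow (j : nat) (x : E) : Prop :=
  if j is j'.+1 then exists y z, [/\ mpow j' y, mpow j' z & x = s * y + t * z]
  else O x.

Arguments mpow : simpl never.

Hypotheses (OD : forall x y, O x -> O y -> O (x + y))
  (OM : forall x y, O x -> O y -> O (x * y))
  (O_cst : forall c, O (cst c)) (Os : O s) (Ot : O t).
Hypothesis O_value : forall x, O x -> exists c, mpow 1 (x - cst c).
Hypothesis O_unit : forall x, mpow 1 x -> 1 - x != 0 /\ O (1 - x)^-1.
Hypotheses (J0 : J 0) (JD : forall x y, J x -> J y -> J (x + y))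
  (JM : forall x y, O x -> J y -> J (x * y)).

Lemma mpowD j x y : mpow j x -> mpow j y -> mpow j (x + y).
Proof.
elim: j x y => [|j IH] x y; first exact: OD.
move=> [x1 [x2 [mx1 mx2 ->]]] [y1 [y2 [my1 my2 ->]]].
exists (x1 + y1), (x2 + y2); split; [exact: IH | exact: IH | ring].
Qed.

Lemma mpowMO j x y : O x -> mpow j y -> mpow j (x * y).
Proof.
elim: j y => [|j IH] y Ox; first exact: OM.
move=> [y1 [y2 [my1 my2 ->]]].
by exists (x * y1), (x * y2); split; [exact: IH | exact: IH | ring].
Qed.

Lemma mpowZ j c x : mpow j x -> mpow j (cst c * x).
Proof. exact: mpowMO. Qed.

Lemma mpowN j x : mpow j x -> mpow j (- x).
Proof. by move/(mpowZ (- 1)); rewrite rmorphN1 mulN1r. Qed.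

Lemma mpow_s j x : mpow j x -> mpow j.+1 (s * x).
Proof.
move=> mx; exists x, (cst 0 * x); split; [by []|exact: mpowZ|].
by rewrite rmorph0; ring.
Qed.

Lemma mpow_t j x : mpow j x -> mpow j.+1 (t * x).
Proof.
move=> mx; exists (cst 0 * x), x; split; [exact: mpowZ|by []|].
by rewrite rmorph0; ring.
Qed.

Lemma mpow_le j x : mpow j.+1 x -> mpow j x.
Proof.
elim: j x => [|j IH] x [y [z [my mz ->]]]; first by apply: OD; apply: OM.
by apply: mpowD; [apply: mpow_s|apply: mpow_t]; apply: IH.
Qed.

Lemma mpowM i j x y : mpow i x -> mpow j y -> mpow (i + j) (x * y).
Proof.
elim: i x => [|i IH] x; first exact: mpowMO.
move=> [x1 [x2 [mx1 mx2 ->]]] my; rewrite mulrDl -!mulrA.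
by apply: mpowD; [apply: mpow_s|apply: mpow_t]; apply: IH.
Qed.

(** [x'] represents the class of [x] in [m^j / m^(j+1)]; this class may be zero. *)
Definition leads j x x' : Prop := mpow j x' /\ mpow j.+1 (x - x').

Lemma leadsM i j x x' y y' :
  leads i x x' -> leads j y y' -> leads (i + j) (x * y) (x' * y').
Proof.
move=> [mx dx] [my dy]; split; first exact: mpowM.
have -> : x * y - x' * y' = (x - x') * y' + x' * (y - y') + (x - x') * (y - y').
  by ring.
apply: mpowD; first apply: mpowD.
- by rewrite -addSn; apply: mpowM.
- by rewrite -addnS; apply: mpowM.
- by apply: mpow_le; rewrite -addnS -addSn; apply: mpowM.
Qed.

Lemma leadsD j x x' y y' :
  leads j x x' -> leads j y y' -> leads j (x + y) (x' + y').
Proof.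
move=> [mx dx] [my dy]; split; first exact: mpowD.
have -> : x + y - (x' + y') = (x - x') + (y - y') by ring.
exact: mpowD.
Qed.

Lemma leads0 j x : mpow j.+1 x -> leads j x 0.
Proof.
move=> mx; split; last by rewrite subr0.
by rewrite -(mul0r x) -(rmorph0 cst); apply/mpowZ/mpow_le.
Qed.

(* [mpow (j + k)] is generated over [mpow k] by the monomials of degree [j];
   the factor [w] makes the induction go through. *)
Lemma mpow_monomials (P : E -> Prop) j k w :
  (forall x y, P x -> P y -> P (x + y)) ->
  (forall i y, (i <= j)%N -> mpow k y -> P (w * (s ^+ i * t ^+ (j - i)) * y)) ->
  forall x, mpow (j + k) x -> P (w * x).
Proof.
move=> PD; elim: j w => [|j IH] w Pw x.
  by move/(Pw 0%N _ (leqnn _)); rewrite expr0 !mulr1.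
move=> [y [z [my mz ->]]]; rewrite mulrDr !mulrA; apply: PD.
  apply: IH => // i c ij mc; have := Pw i.+1 c ij mc.
  by rewrite subSS exprS !mulrA.
apply: IH => // i c ij mc; have := Pw i c (leqW ij) mc.
by rewrite subSn // exprS; congr P; ring.
Qed.

(** Membership in [J + m G]. The coefficients in [m] are peeled off one generator at a time, the
    form needed for an induction on [G]. *)
Fixpoint generated (G : seq E) (x : E) : Prop :=
  if G is g :: G' then exists2 y, mpow 1 y & generated G' (x - y * g) else J x.

Lemma mpow0 j : mpow j 0.
Proof.
elim: j => [|j IH]; first by rewrite -(rmorph0 cst); apply: O_cst.
by exists 0, 0; split=> //; rewrite !mulr0 addr0.
Qed.

Lemma generatedD G x y : generated G x -> generated G y -> generated G (x + y).
Proof.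
elim: G x y => [|g G IH] x y /=; first exact: JD.
move=> [x1 mx1 gx] [y1 my1 gy]; exists (x1 + y1); first exact: mpowD.
have -> : x + y - (x1 + y1) * g = (x - x1 * g) + (y - y1 * g) by ring.
exact: IH.
Qed.

Lemma generatedM G x y : O x -> generated G y -> generated G (x * y).
Proof.
elim: G y => [|g G IH] y Ox /=; first exact: JM.
move=> [y1 my1 gy]; exists (x * y1); first exact: mpowMO.
by rewrite -mulrA -mulrBr; apply: IH.
Qed.

Lemma generated_J G x : J x -> generated G x.
Proof.
elim: G x => [|g G IH] x //= Jx; exists 0; first exact: mpow0.
by rewrite mul0r subr0; apply: IH.
Qed.

Lemma generated_mem G g y : g \in G -> mpow 1 y -> generated G (y * g).
Proof.
elim: G => [//|g' G IH]; rewrite in_cons => /orP[/eqP<-|gG] my /=.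
  by exists y => //; rewrite subrr; apply: generated_J.
by exists 0; [exact: mpow0 | rewrite mul0r subr0; apply: IH].
Qed.

(** The relation for the first generator puts [(1 - y) g] in [J] plus [m] times the others, and
    [1 - y] is a unit; so [g] can be eliminated from the other relations, and induction replaces the
    determinant argument. *)
Lemma nakayama G : (forall g, g \in G -> generated G g) -> forall g, g \in G -> J g.
Proof.
elim: G => [//|g G IH] gen.
have [y my gy] := gen g (mem_head _ _).
have gG : generated G g.
  have [u0 Ou] := O_unit my.
  have -> : g = (1 - y)^-1 * (g - y * g) by field.
  exact: generatedM.
have JG : forall g', g' \in G -> J g'.
  apply: IH => g' g'G; have [|z mz gz] := gen g'; first by rewrite in_cons g'G orbT.
  rewrite -(subrK (z * g) g'); apply: generatedD => //.
  by apply: generatedM => //; apply: (@mpow_le 0).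
suff genJ G' x : (forall g', g' \in G' -> J g') -> generated G' x -> J x.
  by move=> g'; rewrite in_cons => /orP[/eqP->|/JG//]; apply: genJ gG.
elim: G' x => [//|g1 G' IHG'] x JG' [z mz gz].
rewrite -(subrK (z * g1) x); apply: JD.
  by apply: IHG' gz => g' g'G; apply: JG'; rewrite in_cons g'G orbT.
by apply: JM; [apply: (@mpow_le 0) | apply: JG'; apply: mem_head].
Qed.

Definition modJ j x : Prop := exists2 y, J y & mpow j (x - y).

(** The hypothesis says that [m^j] is contained in [J + m m^j]; the monomials of degree [j] are the
    generators to which Nakayama's lemma applies. *)
Lemma mpow_in_J j :
  (forall i, (i <= j)%N -> modJ j.+1 (s ^+ i * t ^+ (j - i))) ->
  forall x, mpow j x -> J x.
Proof.
move=> mono; pose G := [seq s ^+ i * t ^+ (j - i) | i <- iota 0 j.+1].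
have memG i : (i <= j)%N -> s ^+ i * t ^+ (j - i) \in G.
  by move=> ij; apply/mapP; exists i; rewrite // mem_iota ltnS.
have JG : forall g, g \in G -> J g.
  apply: nakayama => g /mapP[i + ->]; rewrite mem_iota add0n ltnS => ij.
  have [y Jy my] := mono i ij; rewrite -[X in generated G X](subrK y).
  apply: generatedD; last exact: generated_J.
  rewrite -[_ - _]mul1r; apply: (@mpow_monomials _ j 1); last by rewrite addn1.
    exact: generatedD.
  by move=> k z kj mz; rewrite mul1r mulrC; apply: generated_mem mz; apply: memG.
move=> x mx; rewrite -[x]mul1r; apply: (@mpow_monomials _ j 0); last by rewrite addn0.
  exact: JD.
by move=> i y ij Oy; rewrite mul1r mulrC; apply: JM => //; apply/JG/memG.
Qed.

Lemma modJD j x y : modJ j x -> modJ j y -> modJ j (x + y).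
Proof.
move=> [x1 Jx mx] [y1 Jy my]; exists (x1 + y1); first exact: JD.
by rewrite opprD addrACA; apply: mpowD.
Qed.

Lemma modJM j x y : O x -> modJ j y -> modJ j (x * y).
Proof.
move=> Ox [y1 Jy my]; exists (x * y1); first exact: JM.
by rewrite -mulrBr; apply: mpowMO.
Qed.

Lemma modJ_comb j a b x y z :
  modJ j x -> modJ j y -> z = cst a * x + cst b * y -> modJ j z.
Proof. by move=> mx my ->; apply: modJD; apply: modJM. Qed.

Lemma modJ_s j x : modJ j x -> modJ j.+1 (s * x).
Proof.
move=> [y Jy my]; exists (s * y); first exact: JM.
by rewrite -mulrBr; apply: mpow_s.
Qed.

Lemma modJ_t j x : modJ j x -> modJ j.+1 (t * x).
Proof.
move=> [y Jy my]; exists (t * y); first exact: JM.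
by rewrite -mulrBr; apply: mpow_t.
Qed.

Lemma leads_modJ j x x' : J x -> leads j x x' -> modJ j.+1 x'.
Proof.
move=> Jx [_ dx]; exists x => //.
by rewrite -opprB; apply: mpowN.
Qed.

Definition spans (B : seq E) (x : E) : Prop :=
  exists c : nat -> K, J (x - \sum_(i < size B) cst (c i) * B`_i).

Lemma spansD B x y : spans B x -> spans B y -> spans B (x + y).
Proof.
move=> [c Jx] [d Jy]; exists (fun i => c i + d i).
under eq_bigr do rewrite rmorphD mulrDl.
by rewrite big_split opprD addrACA; apply: JD.
Qed.

Lemma spansZ B a x : spans B x -> spans B (cst a * x).
Proof.
move=> [c Jx]; exists (fun i => a * c i).
under eq_bigr do rewrite rmorphM -mulrA.
by rewrite -big_distrr -mulrBr; apply: JM.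
Qed.

Lemma spans_comb B a b x y z :
  spans B x -> spans B y -> z = cst a * x + cst b * y -> spans B z.
Proof. by move=> mx my ->; apply: spansD; apply: spansZ. Qed.

Lemma spans_J B x : J x -> spans B x.
Proof.
move=> Jx; exists (fun=> 0); rewrite big1 ?subr0 // => i _.
by rewrite rmorph0 mul0r.
Qed.

Lemma spans_nth B i : (i < size B)%N -> spans B B`_i.
Proof.
move=> iB; exists (fun k => (k == i)%:R); rewrite (bigD1 (Ordinal iB)) //= eqxx.
rewrite rmorph1 mul1r big1 ?addr0 ?subrr // => k.
by rewrite -val_eqE /= => /negPf->; rewrite rmorph0 mul0r.
Qed.

Lemma spans_mem B x : x \in B -> spans B x.
Proof. by move=> xB; rewrite -(nth_index 0 xB); apply: spans_nth; rewrite index_mem. Qed.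

Lemma mono_mpow i j : (i <= j)%N -> mpow j (s ^+ i * t ^+ (j - i)).
Proof.
have O1 : O 1 by rewrite -(rmorph1 cst).
have mt k : mpow k (t ^+ k).
  by elim: k => // k IH; rewrite exprS; apply: mpow_t.
elim: i j => [|i IH] j; first by rewrite subn0 expr0 mul1r.
case: j => // j ij; rewrite exprS subSS -mulrA; apply: mpow_s; exact: IH.
Qed.

(** Up to an element of [m], the coefficient of a monomial of degree [j] is a constant, and the
    error has order [j + 1]. Used as a descending induction on the order. *)
Lemma mpow_spans B j :
  (forall x, mpow j.+1 x -> spans B x) ->
  (forall i, (i <= j)%N -> spans B (s ^+ i * t ^+ (j - i))) ->
  forall x, mpow j x -> spans B x.
Proof.
move=> spB mono x mx; rewrite -[x]mul1r; apply: (@mpow_monomials _ j 0).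
- exact: spansD.
- move=> i y ij Oy; rewrite mul1r; have [c mc] := O_value Oy.
  rewrite -(subrK (cst c) y) mulrDr; apply: spansD.
    by apply: spB; rewrite -[j.+1]addn1; apply: mpowM mc; apply: (mono_mpow ij).
  by rewrite mulrC; apply: spansZ; apply: mono.
- by rewrite addn0.
Qed.

Lemma modJ_spans B j x :
  (forall y, mpow j y -> spans B y) -> modJ j x -> spans B x.
Proof.
move=> spB [y Jy my]; rewrite -(subrK y x); apply: spansD; first exact: spB.
exact: spans_J.
Qed.

(** * Quotients by the partial derivatives of a product of two, three or four linear forms *)

Local Ltac cfield := field; repeat (apply/andP; split).

Hypotheses (two_neq0 : 2%:R != 0 :> K) (three_neq0 : 3%:R != 0 :> K).

Let cst_neq0 c : c != 0 -> cst c != 0.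
Proof. by rewrite fmorph_eq0. Qed.

(** The leading forms are the partial derivatives of [A s t], so [J] contains [m]. *)
Lemma spans_double A : A != 0 ->
  modJ 2 (cst A * t) -> modJ 2 (cst A * s) ->
  forall x, O x -> spans [:: 1] x.
Proof.
move=> A0 e1 e2; have cA := cst_neq0 A0.
have m1 : forall x, mpow 1 x -> J x.
  apply: mpow_in_J => -[|[|//]] _.
    by apply: (modJ_comb (a := A^-1) (b := 0) e1 e1); cfield.
  by apply: (modJ_comb (a := A^-1) (b := 0) e2 e2); cfield.
apply: (@mpow_spans _ 0) => [x /m1|[|//] _]; first exact: spans_J.
by apply: spans_mem; rewrite mul1r mem_seq1.
Qed.

(** The leading forms are the partial derivatives of [s t (A s + B t)]. They leave 1, 2, 1 monomials
    in degrees 0, 1, 2, and [J] contains [m^3]. *)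
Lemma spans_triple A B : A != 0 -> B != 0 ->
  modJ 3 (cst (2 * A) * (s * t) + cst B * t ^+ 2) ->
  modJ 3 (cst A * s ^+ 2 + cst (2 * B) * (s * t)) ->
  forall x, O x -> spans [:: 1; s; t; s * t] x.
Proof.
move=> A0 B0 e1 e2; have [cA cB] := (cst_neq0 A0, cst_neq0 B0).
have c3 : 3%:R != 0 :> E by rewrite -(rmorph_nat cst) cst_neq0.
set L := [:: _; _; _; _].
have s2t : modJ 4 (s ^+ 2 * t ^+ 1).
  apply: (modJ_comb (a := 2 / (3 * A)) (b := - 1 / (3 * A)) (modJ_s e1) (modJ_t e2)).
  by cfield.
have st2 : modJ 4 (s ^+ 1 * t ^+ 2).
  apply: (modJ_comb (a := 2 / (3 * B)) (b := - 1 / (3 * B)) (modJ_t e2) (modJ_s e1)).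
  by cfield.
have m3 : forall x, mpow 3 x -> J x.
  apply: mpow_in_J => -[|[|[|[|//]]]] _.
  - by apply: (modJ_comb (a := B^-1) (b := - 2 * A / B) (modJ_t e1) st2); cfield.
  - exact: st2.
  - exact: s2t.
  - by apply: (modJ_comb (a := A^-1) (b := - 2 * B / A) (modJ_s e2) s2t); cfield.
have sp3 x : mpow 3 x -> spans L x by move/m3; apply: spans_J.
have st : spans L (s ^+ 1 * t ^+ 1) by apply: spans_mem; rewrite !inE eqxx !orbT.
have sp2 : forall x, mpow 2 x -> spans L x.
  apply: mpow_spans => // -[|[|[|//]]] _.
  - apply: (spans_comb (a := B^-1) (b := - 2 * A / B) (modJ_spans sp3 e1) st).
    by cfield.
  - exact: st.
  - apply: (spans_comb (a := A^-1) (b := - 2 * B / A) (modJ_spans sp3 e2) st).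
    by cfield.
have sp1 : forall x, mpow 1 x -> spans L x.
  apply: mpow_spans => // -[|[|//]] _; apply: spans_mem;
  by rewrite !inE ?expr0 ?expr1 ?mulr1 ?mul1r !eqxx !orbT.
apply: (@mpow_spans _ 0) => // -[|//] _; apply: spans_mem.
by rewrite mul1r inE eqxx.
Qed.

(** The leading forms are the partial derivatives of [s t (A s^2 + B s t + C t^2)], whose linear
    factors are distinct when [A], [C] and the discriminant are nonzero. They leave 1, 2, 3, 2, 1
    monomials in degrees 0 to 4, and [J] contains [m^5]. *)
Lemma spans_quadruple A B C : A != 0 -> C != 0 -> B ^+ 2 - 4 * A * C != 0 ->
  modJ 4 (cst (3 * A) * (s ^+ 2 * t) + cst (2 * B) * (s * t ^+ 2) + cst C * t ^+ 3) ->
  modJ 4 (cst A * s ^+ 3 + cst (2 * B) * (s ^+ 2 * t) + cst (3 * C) * (s * t ^+ 2)) ->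
  forall x, O x ->
    spans [:: 1; s; t; s ^+ 2; s * t; t ^+ 2; s ^+ 2 * t; s * t ^+ 2;
              s ^+ 2 * t ^+ 2] x.
Proof.
move=> A0 C0 dABC e1 e2; have [cA cC] := (cst_neq0 A0, cst_neq0 C0).
have c2 : 2%:R != 0 :> E by rewrite -(rmorph_nat cst) cst_neq0.
have c8 : 8%:R != 0 :> E.
  have -> : 8%:R = 2%:R * 2%:R * 2%:R :> E by ring.
  by rewrite !mulf_neq0.
have := cst_neq0 dABC; rewrite rmorphB rmorphXn !rmorphM rmorph_nat => cd.
set L := [:: _; _; _; _; _; _; _; _; _].
(* Eliminating [s ^+ 3 * t] between [modJ_t e2] and [modJ_s e1], and symmetrically for [q2],
   expresses [s * t ^+ 3] and [s ^+ 3 * t] through [s ^+ 2 * t ^+ 2]. *)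
have q1 : modJ 5 (s * t ^+ 3 + cst (B / (2 * C)) * (s ^+ 2 * t ^+ 2)).
  apply: (modJ_comb (a := 3 / (8 * C)) (b := - 1 / (8 * C)) (modJ_t e2) (modJ_s e1)).
  by cfield.
have q2 : modJ 5 (s ^+ 3 * t + cst (B / (2 * A)) * (s ^+ 2 * t ^+ 2)).
  apply: (modJ_comb (a := 3 / (8 * A)) (b := - 1 / (8 * A)) (modJ_s e1) (modJ_t e2)).
  by cfield.
(* In degree five, [q1] and [q2] form a linear system in [s ^+ 3 * t ^+ 2] and [s ^+ 2 * t ^+ 3]
   with determinant [1 - B^2 / (4 A C)]; here the discriminant is inverted. *)
have s3t2 : modJ 6 (s ^+ 3 * t ^+ 2).
  apply: (modJ_comb (a := - 4 * A * C / (B ^+ 2 - 4 * A * C))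
    (b := 2 * B * C / (B ^+ 2 - 4 * A * C)) (modJ_t q2) (modJ_s q1)).
  by cfield.
have s2t3 : modJ 6 (s ^+ 2 * t ^+ 3).
  apply: (modJ_comb (a := 1) (b := - B / (2 * C)) (modJ_s q1) s3t2).
  by cfield.
have s4t : modJ 6 (s ^+ 4 * t ^+ 1).
  apply: (modJ_comb (a := 1) (b := - B / (2 * A)) (modJ_s q2) s3t2).
  by cfield.
have st4 : modJ 6 (s ^+ 1 * t ^+ 4).
  apply: (modJ_comb (a := 1) (b := - B / (2 * C)) (modJ_t q1) s2t3).
  by cfield.
have m5 : forall x, mpow 5 x -> J x.
  apply: mpow_in_J => -[|[|[|[|[|[|//]]]]]] _.
  - have p : modJ 6 (cst C * t ^+ 5 + cst (2 * B) * (s * t ^+ 4)).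
      by apply: (modJ_comb (a := 1) (b := - 3 * A) (modJ_t (modJ_t e1)) s2t3); cfield.
    by apply: (modJ_comb (a := C^-1) (b := - 2 * B / C) p st4); cfield.
  - exact: st4.
  - exact: s2t3.
  - exact: s3t2.
  - exact: s4t.
  - have p : modJ 6 (cst A * s ^+ 5 + cst (2 * B) * (s ^+ 4 * t)).
      by apply: (modJ_comb (a := 1) (b := - 3 * C) (modJ_s (modJ_s e2)) s3t2); cfield.
    by apply: (modJ_comb (a := A^-1) (b := - 2 * B / A) p s4t); cfield.
have sp5 x : mpow 5 x -> spans L x by move/m5; apply: spans_J.
have s2t2 : spans L (s ^+ 2 * t ^+ 2).
  by apply: spans_mem; rewrite !inE eqxx !orbT.
have st3 : spans L (s ^+ 1 * t ^+ 3).
  apply: (spans_comb (a := 1) (b := - B / (2 * C)) (modJ_spans sp5 q1) s2t2).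
  by cfield.
have s3t : spans L (s ^+ 3 * t ^+ 1).
  apply: (spans_comb (a := 1) (b := - B / (2 * A)) (modJ_spans sp5 q2) s2t2).
  by cfield.
have sp4 : forall x, mpow 4 x -> spans L x.
  apply: mpow_spans => // -[|[|[|[|[|//]]]]] _.
  - have p : spans L (cst C * t ^+ 4 + cst (2 * B) * (s * t ^+ 3)).
      by apply: (spans_comb (a := 1) (b := - 3 * A) (modJ_spans sp5 (modJ_t e1)) s2t2); cfield.
    by apply: (spans_comb (a := C^-1) (b := - 2 * B / C) p st3); cfield.
  - exact: st3.
  - exact: s2t2.
  - exact: s3t.
  - have p : spans L (cst A * s ^+ 4 + cst (2 * B) * (s ^+ 3 * t)).
      by apply: (spans_comb (a := 1) (b := - 3 * C) (modJ_spans sp5 (modJ_s e2)) s2t2); cfield.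
    by apply: (spans_comb (a := A^-1) (b := - 2 * B / A) p s3t); cfield.
have s2t : spans L (s ^+ 2 * t ^+ 1).
  by apply: spans_mem; rewrite expr1 !inE eqxx !orbT.
have st2 : spans L (s ^+ 1 * t ^+ 2).
  by apply: spans_mem; rewrite expr1 !inE eqxx !orbT.
have sp3 : forall x, mpow 3 x -> spans L x.
  apply: mpow_spans => // -[|[|[|[|//]]]] _.
  - have p : spans L (cst C * t ^+ 3 + cst (2 * B) * (s * t ^+ 2)).
      by apply: (spans_comb (a := 1) (b := - 3 * A) (modJ_spans sp4 e1) s2t); cfield.
    by apply: (spans_comb (a := C^-1) (b := - 2 * B / C) p st2); cfield.
  - exact: st2.
  - exact: s2t.
  - have p : spans L (cst A * s ^+ 3 + cst (2 * B) * (s ^+ 2 * t)).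
      by apply: (spans_comb (a := 1) (b := - 3 * C) (modJ_spans sp4 e2) st2); cfield.
    by apply: (spans_comb (a := A^-1) (b := - 2 * B / A) p s2t); cfield.
have sp2 : forall x, mpow 2 x -> spans L x.
  apply: mpow_spans => // -[|[|[|//]]] _; apply: spans_mem;
  by rewrite !inE ?expr0 ?expr1 ?mulr1 ?mul1r !eqxx !orbT.
have sp1 : forall x, mpow 1 x -> spans L x.
  apply: mpow_spans => // -[|[|//]] _; apply: spans_mem;
  by rewrite !inE ?expr0 ?expr1 ?mulr1 ?mul1r !eqxx !orbT.
apply: (@mpow_spans _ 0) => // -[|//] _; apply: spans_mem.
by rewrite mul1r inE eqxx.
Qed.

Lemma leads_mpow j x x' : leads j x x' -> mpow j x.
Proof. by move=> [mx dx]; rewrite -(subrK x' x); apply: mpowD => //; apply: mpow_le. Qed.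

(* A curve [x = 0] through the point, with leading form [a s + b t], together
   with its partial derivatives [x1], [x2]. *)
Definition branch (x x1 x2 : E) (a b : K) : Prop :=
  [/\ leads 1 x (cst a * s + cst b * t), leads 0 x1 (cst a) & leads 0 x2 (cst b)].

(** The branches [x] and [y] serve as coordinate axes, and the unit [u] stands for the curves
    missing the point. The two hypotheses on [J] are Leibniz expansions of the derivatives of
    [x y u]; the terms with [u1] and [u2] have higher order and drop out of the leading forms. *)
Lemma spans_branches2 x x1 x2 y y1 y2 u u1 u2 a b c :
  branch x x1 x2 a 0 -> branch y y1 y2 0 b -> leads 0 u (cst c) ->
  O u1 -> O u2 -> a != 0 -> b != 0 -> c != 0 ->
  J (x1 * (y * u) + x * (y1 * u + y * u1)) ->
  J (x2 * (y * u) + x * (y2 * u + y * u2)) ->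
  forall z, O z -> spans [:: 1] z.
Proof.
move=> [lx lx1 lx2] [ly ly1 ly2] lu Ou1 Ou2 a0 b0 c0.
have err v : O v -> leads 1 (x * (y * v)) 0.
  move=> Ov; apply: leads0; apply: (mpowM (j := 1) (leads_mpow lx)).
  exact: (mpowM (j := 0) (leads_mpow ly)).
rewrite !mulrDr !addrA => J1 J2.
have l1 := leadsD (leadsD (leadsM lx1 (leadsM ly lu)) (leadsM lx (leadsM ly1 lu))) (err _ Ou1).
have l2 := leadsD (leadsD (leadsM lx2 (leadsM ly lu)) (leadsM lx (leadsM ly2 lu))) (err _ Ou2).
apply: (@spans_double (a * b * c)); first by rewrite !mulf_neq0.
  apply: (modJ_comb (a := 1) (b := 0) (leads_modJ J1 l1) (leads_modJ J1 l1)).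
  by ring.
apply: (modJ_comb (a := 1) (b := 0) (leads_modJ J2 l2) (leads_modJ J2 l2)).
by ring.
Qed.

Lemma spans_branches3 x x1 x2 y y1 y2 z z1 z2 u u1 u2 a b a3 b3 c :
  branch x x1 x2 a 0 -> branch y y1 y2 0 b -> branch z z1 z2 a3 b3 ->
  leads 0 u (cst c) -> O u1 -> O u2 ->
  a != 0 -> b != 0 -> a3 != 0 -> b3 != 0 -> c != 0 ->
  J (x1 * (y * (z * u)) + x * (y1 * (z * u) + y * (z1 * u + z * u1))) ->
  J (x2 * (y * (z * u)) + x * (y2 * (z * u) + y * (z2 * u + z * u2))) ->
  forall w, O w -> spans [:: 1; s; t; s * t] w.
Proof.
move=> [lx lx1 lx2] [ly ly1 ly2] [lz lz1 lz2] lu Ou1 Ou2 a0 b0 a30 b30 c0.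
have err v : O v -> leads 2 (x * (y * (z * v))) 0.
  move=> Ov; apply: leads0; apply: (mpowM (j := 2) (leads_mpow lx)).
  by apply: (mpowM (j := 1) (leads_mpow ly)); apply: (mpowM (j := 0) (leads_mpow lz)).
rewrite !mulrDr !addrA => J1 J2.
have l1 := leadsD (leadsD (leadsD (leadsM lx1 (leadsM ly (leadsM lz lu)))
  (leadsM lx (leadsM ly1 (leadsM lz lu)))) (leadsM lx (leadsM ly (leadsM lz1 lu))))
  (err _ Ou1).
have l2 := leadsD (leadsD (leadsD (leadsM lx2 (leadsM ly (leadsM lz lu)))
  (leadsM lx (leadsM ly2 (leadsM lz lu)))) (leadsM lx (leadsM ly (leadsM lz2 lu))))
  (err _ Ou2).
apply: (@spans_triple (a * b * c * a3) (a * b * c * b3)).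
- by rewrite !mulf_neq0.
- by rewrite !mulf_neq0.
- apply: (modJ_comb (a := 1) (b := 0) (leads_modJ J1 l1) (leads_modJ J1 l1)).
  by ring.
- apply: (modJ_comb (a := 1) (b := 0) (leads_modJ J2 l2) (leads_modJ J2 l2)).
  by ring.
Qed.

Lemma spans_branches4 x x1 x2 y y1 y2 z z1 z2 v v1 v2 u u1 u2 a b a3 b3 a4 b4 c :
  branch x x1 x2 a 0 -> branch y y1 y2 0 b -> branch z z1 z2 a3 b3 ->
  branch v v1 v2 a4 b4 -> leads 0 u (cst c) -> O u1 -> O u2 ->
  a != 0 -> b != 0 -> a3 != 0 -> b3 != 0 -> a4 != 0 -> b4 != 0 ->
  a3 * b4 - a4 * b3 != 0 -> c != 0 ->
  J (x1 * (y * (z * (v * u))) +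
     x * (y1 * (z * (v * u)) + y * (z1 * (v * u) + z * (v1 * u + v * u1)))) ->
  J (x2 * (y * (z * (v * u))) +
     x * (y2 * (z * (v * u)) + y * (z2 * (v * u) + z * (v2 * u + v * u2)))) ->
  forall w, O w ->
    spans [:: 1; s; t; s ^+ 2; s * t; t ^+ 2; s ^+ 2 * t; s * t ^+ 2;
              s ^+ 2 * t ^+ 2] w.
Proof.
move=> [lx lx1 lx2] [ly ly1 ly2] [lz lz1 lz2] [lv lv1 lv2] lu Ou1 Ou2.
move=> a0 b0 a30 b30 a40 b40 d0 c0.
have err r : O r -> leads 3 (x * (y * (z * (v * r)))) 0.
  move=> Or; apply: leads0; apply: (mpowM (j := 3) (leads_mpow lx)).
  apply: (mpowM (j := 2) (leads_mpow ly)); apply: (mpowM (j := 1) (leads_mpow lz)).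
  exact: (mpowM (j := 0) (leads_mpow lv)).
rewrite !mulrDr !addrA => J1 J2.
have lvu := leadsM lv lu; have lzvu := leadsM lz lvu.
have l1 := leadsD (leadsD (leadsD (leadsD (leadsM lx1 (leadsM ly lzvu))
  (leadsM lx (leadsM ly1 lzvu))) (leadsM lx (leadsM ly (leadsM lz1 lvu))))
  (leadsM lx (leadsM ly (leadsM lz (leadsM lv1 lu))))) (err _ Ou1).
have l2 := leadsD (leadsD (leadsD (leadsD (leadsM lx2 (leadsM ly lzvu))
  (leadsM lx (leadsM ly2 lzvu))) (leadsM lx (leadsM ly (leadsM lz2 lvu))))
  (leadsM lx (leadsM ly (leadsM lz (leadsM lv2 lu))))) (err _ Ou2).
pose k := a * b * c.
apply: (@spans_quadruple (k * (a3 * a4)) (k * (a3 * b4 + a4 * b3)) (k * (b3 * b4))).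
- by rewrite !mulf_neq0.
- by rewrite !mulf_neq0.
(* The binary quadratic form splits into two linear forms, so its discriminant is the square of
   their determinant, up to the factor [k]. *)
- have -> : (k * (a3 * b4 + a4 * b3)) ^+ 2 - 4 * (k * (a3 * a4)) * (k * (b3 * b4))
      = (k * (a3 * b4 - a4 * b3)) ^+ 2 by ring.
  by rewrite expf_neq0 // !mulf_neq0.
- apply: (modJ_comb (a := 1) (b := 0) (leads_modJ J1 l1) (leads_modJ J1 l1)).
  by rewrite /k; ring.
- apply: (modJ_comb (a := 1) (b := 0) (leads_modJ J2 l2) (leads_modJ J2 l2)).
  by rewrite /k; ring.
Qed.

(* Expanding a basis of [O] modulo [J] over a spanning family gives a matrix
   whose left kernel vanishes by uniqueness of coordinates. *)
Lemma basis_size_le B n (e : 'I_n -> E) :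
  (forall x, O x -> spans B x) -> (forall i, O (e i)) ->
  (forall x, O x -> exists! c : 'rV[K]_n, J (x - \sum_i cst (c 0 i) * e i)) ->
  (n <= size B)%N.
Proof.
move=> spB Oe basis; rewrite leqNgt; apply/negP => Bn.
have [D De] := choice (fun i => spB _ (Oe i)).
pose M := \matrix_(i < n, k < size B) D i k.
have: kermx M != 0.
  rewrite -mxrank_eq0 mxrank_ker subn_eq0 -ltnNge.
  exact: leq_ltn_trans (rank_leq_col M) Bn.
case/rowV0Pn=> w /sub_kermxP wM /eqP w0; apply: w0.
have O0 : O 0 by rewrite -(rmorph0 cst).
have [c [_ c_uniq]] := basis 0 O0.
rewrite -(c_uniq w); first apply: c_uniq.
  rewrite big1 ?subr0 // => i _; by rewrite mxE rmorph0 mul0r.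
have -> : 0 - \sum_i cst (w 0 i) * e i =
    \sum_i cst (- w 0 i) * (e i - \sum_(k < size B) cst (D i k) * B`_k).
  under [RHS]eq_bigr do rewrite mulrBr.
  rewrite sub0r sumrB [X in _ - X](_ : _ = 0) ?subr0.
    by rewrite -sumrN; apply: eq_bigr => i _; rewrite rmorphN mulNr.
  under eq_bigr do rewrite big_distrr /=.
  rewrite exchange_big big1 // => k _.
  under eq_bigr do rewrite mulrA -rmorphM.
  rewrite -big_distrl -rmorph_sum /=.
  have /rowP/(_ k) := wM; rewrite !mxE => wMk.
  under eq_bigr do rewrite mulNr.
  rewrite sumrN (_ : \sum_i _ = 0) ?oppr0 ?rmorph0 ?mul0r // -[RHS]wMk.
  by apply: eq_bigr => i _; rewrite mxE.
elim/big_ind: _ => //= i _; exact: JM.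
Qed.

End LocalAlgebra.

(** * Homogeneous polynomials and the local ring at a point *)

(** An induction principle that hides monomials: homogeneous polynomials are built from 1 by
    multiplication by a variable and by linear combinations within one degree. *)
Lemma dhomog_rec (n : nat) (F : fieldType) (P : nat -> {mpoly F[n]} -> Prop) :
  P 0%N 1 -> (forall d f i, P d f -> P d.+1 ('X_i * f)) ->
  (forall d, P d 0) -> (forall d f g, P d f -> P d g -> P d (f + g)) ->
  (forall d c f, P d f -> P d (c *: f)) ->
  forall d f, f \is d.-homog -> P d f.
Proof.
move=> P1 PX P0 PD PZ d f /dhomogP f_d; rewrite [f]mpolyE big_seq.
elim/big_ind: _ => [||m /f_d md]; [exact: P0 | exact: PD | apply: PZ].
elim: d m md {f_d} => [|d IH] m md.
  by have /eqP -> : m == 0%MM; [rewrite -mdeg_eq0 md | rewrite mpolyX0].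
have [i mi] : exists i, m i != 0%N.
  apply: contrapT => m0; suff: mdeg m == 0%N by rewrite md.
  rewrite mdegE sum_nat_eq0; apply/forallP => i; apply/implyP => _.
  by apply: contraT => mi; case: m0; exists i.
have im : (U_(i) <= m)%MM by rewrite lep1mP.
rewrite -(submK im) addmC mpolyXD; apply/PX/IH.
by apply/eqP; rewrite -(eqn_add2r (mdeg U_(i))) -mdegD submK // md mdeg1 addn1.
Qed.

Section Homogeneous.

Variable F : fieldType.
Implicit Types (f g : {mpoly F[3]}) (p w : 'rV[F]_3).

Lemma mderivXU (i j : 'I_3) : ('X_j)^`M(i) = (j == i)%:R%:MP :> {mpoly F[3]}.
Proof.
rewrite mderivX mnm1E; case: eqP => [->|_]; last by rewrite scale0r mpolyC0.
by rewrite scale1r -{1}[U_(i)%MM]addm0 addmC addmK mpolyX0 mpolyC1.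
Qed.

Lemma mpolyXU_homog (i : 'I_3) : 'X_i \in [in F[3], 1.-homog].
Proof. by rewrite dhomogX; apply/eqP; exact: mdeg1. Qed.

Lemma mpolyC_homog (c : F) : c%:MP \in [in F[3], 0.-homog].
Proof. by rewrite -[c%:MP]mulr1 mul_mpolyC rpredZ // dhomog1. Qed.

Lemma mderiv_homog d f i : f \is d.+1.-homog -> f^`M(i) \is d.-homog.
Proof.
pose P e (g : {mpoly F[3]}) := g \is e.-homog /\
  forall i, if e is e'.+1 then g^`M(i) \is e'.-homog else g^`M(i) = 0.
suff H e g : g \is e.-homog -> P e g by move/H => [_]; apply.
move: e g; apply: dhomog_rec.
- by split=> [|k]; [exact: dhomog1 | rewrite -mpolyC1 mderivC].
- move=> e g j [ge gi]; split=> [|k]; first exact: (dhomogM (mpolyXU_homog j) ge).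
  rewrite mderivM mderivXU mul_mpolyC; apply: rpredD; first exact: rpredZ.
  case: e ge gi => [|e] ge gi; first by rewrite gi mulr0 rpred0.
  exact: (dhomogM (mpolyXU_homog j) (gi k)).
- by move=> e; split=> [|k]; [exact: rpred0|case: e => [|e]; rewrite mderiv0 ?rpred0].
- move=> e g h [ge gi] [he hi]; split=> [|k]; first exact: rpredD.
  by case: e ge gi he hi => [|e] ge gi he hi; rewrite mderivD ?rpredD // gi hi addr0.
- move=> e c g [ge gi]; split=> [|k]; first exact: rpredZ.
  by case: e ge gi => [|e] ge gi; rewrite mderivZ ?rpredZ // gi scaler0.
Qed.

Lemma euler_homog d f : f \is d.-homog -> \sum_k 'X_k * f^`M(k) = d%:R *: f.
Proof.
move: d f; apply: dhomog_rec.
- by rewrite scale0r big1 // => k _; rewrite -mpolyC1 mderivC mulr0.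
- move=> d f i IH.
  under eq_bigr do rewrite mderivM mulrDr.
  rewrite big_split /= (bigD1 i) //= big1 => [|k ki]; last first.
    by rewrite mderivXU eq_sym (negPf ki) mpolyC0 mul0r mulr0.
  rewrite mderivXU eqxx mpolyC1 mul1r addr0.
  under eq_bigr do rewrite mulrCA.
  by rewrite -big_distrr IH /= -scalerAr -[d.+1]add1n natrD scalerDl scale1r.
- by move=> d; rewrite scaler0 big1 // => k _; rewrite mderiv0 mulr0.
- move=> d f g IHf IHg; under eq_bigr do rewrite mderivD mulrDr.
  by rewrite big_split IHf IHg scalerDr.
- move=> d c f IH; under eq_bigr do rewrite mderivZ -scalerAr.
  by rewrite -scaler_sumr IH scalerA mulrC scalerA.
Qed.

(** Euler's relation. On the curve it makes the gradient orthogonal to [p], so all tangents at [p]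
    lie in one plane of covectors. *)
Lemma dot_gradient d f p : f \is d.-homog ->
  dot (gradient f p) p = d%:R * f.@[p 0].
Proof.
move/euler_homog/(congr1 (meval (p 0))); rewrite mevalZ raddf_sum => <-.
by apply: eq_bigr => k _; rewrite /= mevalM mevalXU mxE mulrC.
Qed.

Definition linear_form w : {mpoly F[3]} := \sum_k w 0 k *: 'X_k.

Lemma linear_form_homog w : linear_form w \is 1.-homog.
Proof. by apply: rpred_sum => k _; rewrite rpredZ // mpolyXU_homog. Qed.

Lemma meval_linear_form w p : (linear_form w).@[p 0] = dot w p.
Proof. by rewrite raddf_sum; apply: eq_bigr => k _; rewrite /= mevalZ mevalXU. Qed.

Lemma linear_formD a b : linear_form (a + b) = linear_form a + linear_form b.
Proof. by rewrite -big_split; apply: eq_bigr => k _; rewrite mxE scalerDl. Qed.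

Lemma linear_formZ c a : linear_form (c *: a) = c *: linear_form a.
Proof. by rewrite scaler_sumr; apply: eq_bigr => k _; rewrite mxE scalerA. Qed.

Lemma linear_form_delta i : linear_form (delta_mx 0 i) = 'X_i.
Proof.
rewrite /linear_form (bigD1 i) //= mxE !eqxx scale1r big1 ?addr0 // => k ki.
by rewrite mxE (negPf ki) andbF scale0r.
Qed.

Lemma mderiv_linear_form w i : (linear_form w)^`M(i) = (w 0 i)%:MP.
Proof.
rewrite raddf_sum (bigD1 i) //= mderivZ mderivXU eqxx big1 => [|k ki].
  by rewrite addr0 mpolyC1 -mul_mpolyC mulr1.
by rewrite mderivZ mderivXU (negPf ki) mpolyC0 scaler0.
Qed.

Lemma linear_formE f : f \is 1.-homog -> f = linear_form (\row_k f@_U_(k)).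
Proof.
move=> f1; apply/mpolyP => m.
rewrite raddf_sum /=; have [/mdeg1P[i /eqP->]|m1] := boolP (mdeg m == 1%N).
  rewrite (bigD1 i) //= mcoeffZ mcoeffX eqxx mulr1 mxE big1 ?addr0 // => k ki.
  by rewrite mcoeffZ mcoeffX eq_mnm1 (negPf ki) mulr0.
rewrite (dhomog_nemf_coeff f1 m1) big1 // => k _.
rewrite mcoeffZ mcoeffX; have [km|_] := eqVneq U_(k)%MM m; last by rewrite mulr0.
by rewrite -km mdeg1 in m1.
Qed.

Definition derive w f : {mpoly F[3]} := \sum_k w 0 k *: f^`M(k).

Lemma deriveM w f g : derive w (f * g) = derive w f * g + f * derive w g.
Proof.
rewrite big_distrl big_distrr -big_split; apply: eq_bigr => k _ /=.
by rewrite mderivM scalerDr scalerAl scalerAr.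
Qed.

Lemma derive_homog w d f : f \is d.+1.-homog -> derive w f \is d.-homog.
Proof.
by move=> fd; apply: rpred_sum => k _; apply: rpredZ; apply: mderiv_homog.
Qed.

Lemma meval_derive w f p : (derive w f).@[p 0] = dot (gradient f p) w.
Proof.
by rewrite raddf_sum; apply: eq_bigr => k _; rewrite /= mevalZ mxE mulrC.
Qed.

Lemma derive_jacobian w f : jacobian_ideal f (derive w f).
Proof.
by exists (fun k => (w 0 k)%:MP); apply: eq_bigr => k _; rewrite mul_mpolyC.
Qed.

Lemma homog_decomposition (u v h : {mpoly F[3]}) :
  u \is 1.-homog -> v \is 1.-homog -> h \is 1.-homog ->
  (forall i, exists a b c, 'X_i = a *: u + b *: v + c *: h) ->
  forall d f, f \is d.+1.-homog -> exists c A B,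
    [/\ A \is d.-homog, B \is d.-homog & f = c *: h ^+ d.+1 + u * A + v * B].
Proof.
move=> u1 v1 h1 Xuvh d f fd.
pose P e (g : {mpoly F[3]}) := if e is e'.+1 then
    exists c A B, [/\ A \is e'.-homog, B \is e'.-homog
                    & g = c *: h ^+ e + u * A + v * B]
  else exists c, g = c%:MP.
suff H e g : g \is e.-homog -> P e g by exact: H fd.
move: e g {d f fd}; apply: dhomog_rec.
- by exists 1.
- move=> [|d] f i /=.
    move=> [c ->]; have [a [b [a' ->]]] := Xuvh i.
    exists (a' * c), (a * c)%:MP, (b * c)%:MP; split; try exact: mpolyC_homog.
    by rewrite -!mul_mpolyC !mpolyCM expr1; ring.
  move=> [c [A [B [Ad Bd ->]]]]; have [a [b [a' Xi]]] := Xuvh i.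
  exists (a' * c), ('X_i * A + (a * c) *: h ^+ d.+1), ('X_i * B + (b * c) *: h ^+ d.+1).
  have hd : h ^+ d.+1 \is d.+1.-homog by have := dhomogMn d.+1 h1; rewrite mul1n.
  split.
  + by apply: rpredD; [exact: (dhomogM (mpolyXU_homog i) Ad)|exact: rpredZ].
  + by apply: rpredD; [exact: (dhomogM (mpolyXU_homog i) Bd)|exact: rpredZ].
  rewrite !mulrDr -[in LHS]scalerAr {1}Xi -!mul_mpolyC !mpolyCM [h ^+ d.+2]exprS.
  by ring.
- move=> [|d]; first by exists 0.
  by exists 0, 0, 0; split; rewrite ?rpred0 // scale0r !mulr0 !addr0.
- move=> [|d] f g /=.
    by move=> [a ->] [b ->]; exists (a + b); rewrite mpolyCD.
  move=> [a [A [B [Ad Bd ->]]]] [a' [A' [B' [Ad' Bd' ->]]]].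
  exists (a + a'), (A + A'), (B + B'); split; try exact: rpredD.
  by rewrite -!mul_mpolyC !mpolyCD; ring.
- move=> [|d] c f /=.
    by move=> [a ->]; exists (c * a); rewrite mpolyCM mul_mpolyC.
  move=> [a [A [B [Ad Bd ->]]]]; exists (c * a), (c *: A), (c *: B).
  split; try exact: rpredZ.
  by rewrite -!mul_mpolyC !mpolyCM; ring.
Qed.

(* Stated over an abstract field because [field] does not terminate on
   [{fraction {mpoly F[3]}}]. *)
Section Quotients.

Variable K : fieldType.
Implicit Types x y a b c : K.

Lemma quotient_sub_value u v h x y a b c d :
  h != 0 -> b != 0 -> d != 0 -> u * x + v * y = (d * a - c * b) * h ->
  a / b - c / d = u / h * (x / (d * b)) + v / h * (y / (d * b)) :> K.
Proof.
move=> h0 b0 d0 uv.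
have -> : u / h * (x / (d * b)) + v / h * (y / (d * b)) =
  (u * x + v * y) / (h * (d * b)) by field; rewrite h0 b0 d0.
by rewrite uv; field; rewrite h0 b0 d0.
Qed.

Lemma one_sub_quotients u v h a b c d : h != 0 -> b != 0 -> d != 0 ->
  1 - (u / h * (a / b) + v / h * (c / d)) =
  (h * (b * d) - (u * (a * d) + v * (c * b))) / (h * (b * d)) :> K.
Proof. by move=> h0 b0 d0; field; rewrite h0 b0 d0. Qed.

Lemma quotient_sub_linear u v h x y k a b : h != 0 -> k != 0 ->
  (u * x + v * y) / (h * k) - (a * (u / h) + b * (v / h)) =
  u / h * (x / k - a) + v / h * (y / k - b) :> K.
Proof. by move=> h0 k0; field; rewrite h0 k0. Qed.

Lemma quotient_leibniz2 h a b c x x1 y y1 u u1 :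
  h != 0 -> a != 0 -> b != 0 -> c != 0 ->
  x1 / a * (y / (h * b) * (u / c)) +
  x / (h * a) * (y1 / b * (u / c) + y / (h * b) * (u1 * h / c)) =
  (x1 * (y * u) + x * (y1 * u + y * u1)) / (h * (a * (b * c))) :> K.
Proof. by move=> h0 a0 b0 c0; field; rewrite h0 a0 b0 c0. Qed.

Lemma quotient_leibniz3 h a b c d x x1 y y1 z z1 u u1 :
  h != 0 -> a != 0 -> b != 0 -> c != 0 -> d != 0 ->
  x1 / a * (y / (h * b) * (z / (h * c) * (u / d))) +
  x / (h * a) * (y1 / b * (z / (h * c) * (u / d)) +
    y / (h * b) * (z1 / c * (u / d) + z / (h * c) * (u1 * h / d))) =
  (x1 * (y * (z * u)) + x * (y1 * (z * u) + y * (z1 * u + z * u1))) /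
    (h ^+ 2 * (a * (b * (c * d)))) :> K.
Proof. by move=> h0 a0 b0 c0 d0; field; rewrite h0 a0 b0 c0 d0. Qed.

Lemma quotient_leibniz4 h a b c d e x x1 y y1 z z1 v v1 u u1 :
  h != 0 -> a != 0 -> b != 0 -> c != 0 -> d != 0 -> e != 0 ->
  x1 / a * (y / (h * b) * (z / (h * c) * (v / (h * d) * (u / e)))) +
  x / (h * a) * (y1 / b * (z / (h * c) * (v / (h * d) * (u / e))) +
    y / (h * b) * (z1 / c * (v / (h * d) * (u / e)) +
      z / (h * c) * (v1 / d * (u / e) + v / (h * d) * (u1 * h / e)))) =
  (x1 * (y * (z * (v * u))) + x * (y1 * (z * (v * u)) +
    y * (z1 * (v * u) + z * (v1 * u + v * u1)))) /
    (h ^+ 3 * (a * (b * (c * (d * e))))) :> K.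
Proof. by move=> h0 a0 b0 c0 d0 e0; field; rewrite h0 a0 b0 c0 d0 e0. Qed.

End Quotients.

(** The [w]'s are the columns of the inverse of the matrix with rows [g1], [g2] and the [k]-th unit
    vector. It is invertible: a vector killed by [g1] and [g2] is a multiple of [p], whose [k]-th
    coordinate is nonzero. *)
Lemma frame (p g1 g2 : 'rV[F]_3) k : p 0 k != 0 ->
  dot g1 p = 0 -> dot g2 p = 0 -> cross g1 g2 != 0 ->
  exists w1 w2 w3,
    [/\ dot g1 w1 = 1, dot g1 w2 = 0, dot g2 w1 = 0, dot g2 w2 = 1
      & forall q, q = dot q w1 *: g1 + dot q w2 *: g2 + dot q w3 *: delta_mx 0 k].
Proof.
move=> pk g1p g2p g0.
pose M := \matrix_(i < 3) [:: g1; g2; delta_mx 0 k]`_i : 'M[F]_3.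
have [y py] := orthogonal_cross g0 g1p g2p.
have Mu : M \in unitmx.
  rewrite -unitmx_tr -row_free_unit -kermx_eq0; apply/negPn/negP.
  case/rowV0Pn=> w /sub_kermxP/rowP wM /eqP w0; apply: w0.
  have wi (i : 'I_3) : dot [:: g1; g2; delta_mx 0 k]`_i w = 0.
    have := wM i; rewrite !mxE => <-; apply: eq_bigr => l _.
    by rewrite !mxE mulrC.
  have [x wx] := orthogonal_cross g0 (wi o0) (wi o1).
  have wk : w 0 k = 0.
    have := wi o2; rewrite /dot /= (bigD1 k) //= mxE !eqxx mul1r big1 ?addr0 //.
    by move=> l lk; rewrite mxE (negPf lk) andbF mul0r.
  have : x * cross g1 g2 0 k = 0 by move: wk; rewrite wx mxE.
  move/eqP; rewrite mulf_eq0 => /orP[/eqP x0|/eqP nk]; first by rewrite wx x0 scale0r.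
  by move: pk; rewrite py mxE nk mulr0 eqxx.
pose w (i : 'I_3) := (col i (invmx M))^T.
have gw (i j : 'I_3) : dot [:: g1; g2; delta_mx 0 k]`_i (w j) = (i == j)%:R.
  have /matrixP/(_ i j) := mulmxV Mu; rewrite !mxE => <-.
  by apply: eq_bigr => l _; rewrite !mxE.
exists (w o0), (w o1), (w o2); split.
- exact: (gw o0 o0).
- exact: (gw o0 o1).
- exact: (gw o1 o0).
- exact: (gw o1 o1).
move=> q; rewrite -[LHS]mulmx1 -(mulVmx Mu) mulmxA mulmx_sum_row big_ord3.
have row_M (i : 'I_3) : row i M = [:: g1; g2; delta_mx 0 k]`_i by rewrite rowK.
have dq (i : 'I_3) : (q *m invmx M) 0 i = dot q (w i).
  by rewrite mxE; apply: eq_bigr => l _; rewrite !mxE.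
by rewrite !row_M !dq.
Qed.

(** The linear factor restores the degree lost by differentiation, so that constants, whose
    derivative is zero, need no separate treatment later. *)
Lemma derive_mul_homog w d f g :
  f \is d.-homog -> g \is 1.-homog -> derive w f * g \is d.-homog.
Proof.
case: d => [|d] fd g1.
  suff -> : derive w f = 0 by rewrite mul0r rpred0.
  have -> : f = (f@_0%MM)%:MP.
    apply: msize1_polyC; rewrite msizeE; apply/bigmax_leqP_seq => m mf _.
    by have /dhomogP/(_ m mf) := fd; rewrite ltnS => ->.
  by rewrite /derive big1 // => k _; rewrite mderivC scaler0.
by have := dhomogM (derive_homog w fd) g1; rewrite addn1.
Qed.

(** * The local ring at a point and its parameters *)

Notation fr := (@FracField.tofrac {mpoly F[3]}).

Lemma meval_neq0 f p : f.@[p 0] != 0 -> fr f != 0.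
Proof. by apply: contraNneq => /eqP; rewrite tofrac_eq0 => /eqP->; rewrite meval0. Qed.

Section Localization.

Variables (p : 'rV[F]_3) (I : {mpoly F[3]} -> Prop).
Hypotheses (I0 : I 0) (ID : forall a b, I a -> I b -> I (a + b))
  (IM : forall a b, I b -> I (a * b)).

Lemma homog_localization0 : homog_localization I p 0.
Proof.
exists 0%N, 0, 1; split; rewrite ?dhomog1 ?dhomog0 ?meval1 ?oner_eq0 //.
by rewrite rmorph0 mul0r.
Qed.

Lemma homog_localizationD x y : homog_localization I p x ->
  homog_localization I p y -> homog_localization I p (x + y).
Proof.
move=> [k [a [b [Ia ak bk b0 ->]]]] [l [c [d [Ic cl dl d0 ->]]]].
exists (k + l)%N, (d * a + b * c), (b * d); split.
- by apply: ID; apply: IM.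
- by apply: rpredD; [rewrite mulrC|]; apply: dhomogM.
- exact: dhomogM.
- by rewrite mevalM mulf_neq0.
- rewrite rmorphD !rmorphM.
  rewrite (addf_div _ _ (meval_neq0 b0) (meval_neq0 d0)).
  rewrite (mulrC (fr a)).
  rewrite (mulrC (fr c)).
  by [].
Qed.

Lemma homog_localizationM x y : local_ring p x ->
  homog_localization I p y -> homog_localization I p (x * y).
Proof.
move=> [k [a [b [_ ak bk b0 ->]]]] [l [c [d [Ic cl dl d0 ->]]]].
exists (k + l)%N, (a * c), (b * d); split.
- exact: IM.
- exact: dhomogM.
- exact: dhomogM.
- by rewrite mevalM mulf_neq0.
- by rewrite !rmorphM -mulf_div.
Qed.

End Localization.

Section LocalRing.

Variables (p g1 g2 w1 w2 w3 : 'rV[F]_3) (k : 'I_3).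
Hypotheses (pk : p 0 k != 0) (g1p : dot g1 p = 0) (g2p : dot g2 p = 0).
Hypotheses (g1w1 : dot g1 w1 = 1) (g1w2 : dot g1 w2 = 0)
  (g2w1 : dot g2 w1 = 0) (g2w2 : dot g2 w2 = 1).
Hypothesis decomp :
  forall q, q = dot q w1 *: g1 + dot q w2 *: g2 + dot q w3 *: delta_mx 0 k.

(** In the chart where [h] is nonzero, [s] and [t] are the affine equations of the two lines [g1]
    and [g2] through [p], hence local parameters. *)
Let h : {mpoly F[3]} := 'X_k.
Let u := linear_form g1.
Let v := linear_form g2.
Let s := fr u / fr h.
Let t := fr v / fr h.
Let cst : {rmorphism F -> {fraction {mpoly F[3]}}} := fr \o @mpolyC 3 F.

Let hp : h.@[p 0] = p 0 k. Proof. exact: mevalXU. Qed.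
Let up : u.@[p 0] = 0. Proof. by rewrite meval_linear_form. Qed.
Let vp : v.@[p 0] = 0. Proof. by rewrite meval_linear_form. Qed.
Let h0 : fr h != 0. Proof. by apply: (@meval_neq0 _ p); rewrite hp. Qed.
Let h1 : h \is 1.-homog. Proof. exact: mpolyXU_homog. Qed.
Let u1 : u \is 1.-homog. Proof. exact: linear_form_homog. Qed.
Let v1 : v \is 1.-homog. Proof. exact: linear_form_homog. Qed.

Let hn_homog n : h ^+ n \is n.-homog.
Proof. by have := dhomogMn n h1; rewrite mul1n. Qed.

Let hnp n : (h ^+ n).@[p 0] = p 0 k ^+ n.
Proof. by rewrite rmorphXn /= hp. Qed.

Let hn_neq0 n : (h ^+ n).@[p 0] != 0.
Proof. by rewrite hnp expf_neq0. Qed.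

Lemma vanishing_decomposition d (f : {mpoly F[3]}) :
  f \is d.+1.-homog -> f.@[p 0] = 0 ->
  exists A B, [/\ A \is d.-homog, B \is d.-homog & f = u * A + v * B].
Proof.
move=> fd fp; have [i|c [A [B [Ad Bd fE]]]] := homog_decomposition u1 v1 h1 _ fd.
  exists (dot (delta_mx 0 i) w1), (dot (delta_mx 0 i) w2), (dot (delta_mx 0 i) w3).
  by rewrite /h -!linear_form_delta -!linear_formZ -!linear_formD -decomp.
exists A, B; split=> //; rewrite fE.
have : (c *: h ^+ d.+1 + u * A + v * B).@[p 0] = 0 by rewrite -fE.
rewrite !mevalD !mevalM up vp !mul0r !addr0 mevalZ => /eqP.
rewrite mulf_eq0 (negPf (hn_neq0 _)) orbF => /eqP->.
by rewrite scale0r add0r.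
Qed.

Local Notation O := (local_ring p).

Lemma local_ringP d (a b : {mpoly F[3]}) :
  a \is d.-homog -> b \is d.-homog -> b.@[p 0] != 0 -> O (fr a / fr b).
Proof. by move=> ad bd b0; exists d, a, b. Qed.

Lemma local_ring_cst c : O (cst c).
Proof.
rewrite -[cst c]divr1 -(rmorph1 fr); apply: (@local_ringP 0).
- exact: mpolyC_homog.
- exact: dhomog1.
- by rewrite meval1 oner_eq0.
Qed.

Lemma local_ring_value d (a b : {mpoly F[3]}) :
  a \is d.-homog -> b \is d.-homog -> b.@[p 0] != 0 ->
  mpow O s t 1 (fr a / fr b - cst (a.@[p 0] / b.@[p 0])).
Proof.
move=> ad bd b0.
(* This numerator of the difference vanishes at [p]; the factor [h] makes its degree positive, so
   that the decomposition applies even when [d = 0]. *)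
pose f := (b.@[p 0] *: a - a.@[p 0] *: b) * h.
have fd : f \is d.+1.-homog.
  rewrite /f mulrC; apply: (dhomogM h1 (q := _)).
  by apply: rpredB; apply: rpredZ.
have [|A [B [Ad Bd fE]]] := vanishing_decomposition fd.
  by rewrite /f mevalM mevalB !mevalZ mulrC [_ * a.@[_]]mulrC subrr mulr0.
have b0' := meval_neq0 b0.
have bb0 : fr (b.@[p 0] *: b) != 0.
  by apply: (@meval_neq0 _ p); rewrite mevalZ mulf_neq0.
exists (fr A / fr (b.@[p 0] *: b)), (fr B / fr (b.@[p 0] *: b)); split.
- by apply: (@local_ringP d); rewrite ?rpredZ // mevalZ mulf_neq0.
- by apply: (@local_ringP d); rewrite ?rpredZ // mevalZ mulf_neq0.
have -> : cst (a.@[p 0] / b.@[p 0]) = fr a.@[p 0]%:MP / fr b.@[p 0]%:MP.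
  exact: (fmorph_div cst).
rewrite -mul_mpolyC (rmorphM fr).
apply: quotient_sub_value; [exact: h0 | exact: b0' | by rewrite tofrac_eq0 mpolyC_eq0 |].
by rewrite -!(rmorphM fr) -rmorphB -rmorphM -rmorphD !mul_mpolyC -fE.
Qed.

Let Os : O s. Proof. by apply: (@local_ringP 1); rewrite ?hp. Qed.
Let Ot : O t. Proof. by apply: (@local_ringP 1); rewrite ?hp. Qed.

Let OD x y : O x -> O y -> O (x + y). Proof. exact: homog_localizationD. Qed.
Let OM x y : O x -> O y -> O (x * y). Proof. exact: homog_localizationM. Qed.

Let O_value x : O x -> exists c, mpow O s t 1 (x - cst c).
Proof.
move=> [d [a [b [_ ad bd b0 ->]]]].
by exists (a.@[p 0] / b.@[p 0]); apply: (@local_ring_value d).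
Qed.

Let O_unit x : mpow O s t 1 x -> 1 - x != 0 /\ O (1 - x)^-1.
Proof.
move=> [_ [_ [[d [a [b [_ ad bd b0 ->]]]] [e [a' [b' [_ ae be b0' ->]]]] ->]]].
pose N := h * (b * b') - (u * (a * b') + v * (a' * b)).
pose M := h * (b * b').
have Np : N.@[p 0] = M.@[p 0].
  by rewrite mevalB mevalD !mevalM up vp !mul0r add0r subr0.
have M0 : M.@[p 0] != 0 by rewrite !mevalM hp !mulf_neq0.
have N0 : N.@[p 0] != 0 by rewrite Np.
have [b1 b1'] := (meval_neq0 b0, meval_neq0 b0').
have -> : 1 - (s * (fr a / fr b) + t * (fr a' / fr b')) = fr N / fr M.
  rewrite /s /t /N /M (rmorphB fr) (rmorphD fr) !(rmorphM fr).
  by rewrite (one_sub_quotients _ _ _ _ h0 b1 b1').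
have [frM frN] := (meval_neq0 M0, meval_neq0 N0).
split; first exact: mulf_neq0 frN (invr_neq0 frM).
have Md : M \is (1 + (d + e)).-homog by do 2!apply: dhomogM => //.
rewrite invf_div; apply: local_ringP (Md) _ N0.
apply: rpredB => //; apply: rpredD; apply: dhomogM => //; first exact: dhomogM.
by rewrite addnC; apply: dhomogM.
Qed.

(** Writing [f = u A + v B] gives the gradient [A(p) g1 + B(p) g2] at [p]. The dual vectors [w1] and
    [w2] recover these coefficients, which up to a power of [p 0 k] are those of the linear term of
    [f / h^(n+1)]. *)
Lemma branch_at n (f : {mpoly F[3]}) : f \is n.+1.-homog -> f.@[p 0] = 0 ->
  branch cst O s t (fr f / fr (h ^+ n.+1))
    (fr (derive w1 f) / fr (h ^+ n)) (fr (derive w2 f) / fr (h ^+ n))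
    (dot (gradient f p) w1 / p 0 k ^+ n : F) (dot (gradient f p) w2 / p 0 k ^+ n : F).
Proof.
move=> fn fp; split; last 2 first.
- split; first exact: local_ring_cst.
  by rewrite -meval_derive -hnp; apply: (@local_ring_value n); rewrite ?derive_homog.
- split; first exact: local_ring_cst.
  by rewrite -meval_derive -hnp; apply: (@local_ring_value n); rewrite ?derive_homog.
have [A [B [Ad Bd fE]]] := vanishing_decomposition fn fp.
have grad : gradient f p = A.@[p 0] *: g1 + B.@[p 0] *: g2.
  apply/rowP => i; rewrite !mxE fE mderivD !mderivM !mderiv_linear_form.
  by rewrite !(mevalD, mevalM) !mevalC up vp; ring.
have -> : dot (gradient f p) w1 = A.@[p 0].
  by rewrite grad dotC dotDr !dotZr ![dot w1 _]dotC g1w1 g2w1; ring.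
have -> : dot (gradient f p) w2 = B.@[p 0].
  by rewrite grad dotC dotDr !dotZr ![dot w2 _]dotC g1w2 g2w2; ring.
set a : F := A.@[p 0] / _; set b : F := B.@[p 0] / _.
split.
  exists (cst a), (cst b); split; try exact: local_ring_cst.
  by rewrite mulrC [t * _]mulrC.
have -> : fr f / fr (h ^+ n.+1) - (cst a * s + cst b * t) =
    s * (fr A / fr (h ^+ n) - cst a) + t * (fr B / fr (h ^+ n) - cst b).
  rewrite /s /t fE exprS (rmorphD fr) !(rmorphM fr).
  by rewrite (quotient_sub_linear _ _ _ _ _ _ h0 (meval_neq0 (hn_neq0 n))).
exists (fr A / fr (h ^+ n) - cst a), (fr B / fr (h ^+ n) - cst b).
by split=> //; rewrite /a /b -hnp; apply: (@local_ring_value n).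
Qed.

Lemma perp_decomp q : dot q p = 0 -> q = dot q w1 *: g1 + dot q w2 *: g2.
Proof.
move=> qp; rewrite {1}[q]decomp.
have : dot p q = 0 by rewrite dotC.
rewrite [q in dot p q]decomp !dotDr !dotZr ![dot p _]dotC g1p g2p !mulr0 !add0r.
rewrite {2}/dot (bigD1 k) //= mxE !eqxx mul1r big1 ?addr0; last first.
  by move=> l lk; rewrite mxE (negPf lk) andbF mul0r.
by move/eqP; rewrite mulf_eq0 (negPf pk) orbF => /eqP->; rewrite scale0r addr0.
Qed.

(** Turns transversality of two curves at [p] into a nonzero determinant of the coordinates of their
    gradients. *)
Lemma cross_perp q r : dot q p = 0 -> dot r p = 0 ->
  cross q r = (dot q w1 * dot r w2 - dot q w2 * dot r w1) *: cross g1 g2.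
Proof.
move=> /perp_decomp qE /perp_decomp rE; rewrite {1}qE {1}rE.
move: (dot q w1) (dot q w2) (dot r w1) (dot r w2) => a b c d.
by apply/rowP; apply: ord3P; rewrite !mxE /=; ring.
Qed.

Lemma derive_quotient_in w n (f : {mpoly F[3]}) : f \is n.+1.-homog ->
  homog_localization (jacobian_ideal f) p (fr (derive w f) / fr (h ^+ n)).
Proof.
move=> fn; exists n, (derive w f), (h ^+ n); split=> //.
  exact: derive_jacobian.
exact: derive_homog.
Qed.

Lemma jacobian_ideal0 (f : {mpoly F[3]}) : jacobian_ideal f 0.
Proof. by exists (fun=> 0); rewrite big1 // => i _; rewrite mul0r. Qed.

Lemma jacobian_idealD (f a b : {mpoly F[3]}) :
  jacobian_ideal f a -> jacobian_ideal f b -> jacobian_ideal f (a + b).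
Proof.
move=> [c ->] [d ->]; exists (fun i => c i + d i).
by rewrite -big_split; apply: eq_bigr => i _; rewrite mulrDl.
Qed.

Lemma jacobian_idealM (f a b : {mpoly F[3]}) :
  jacobian_ideal f b -> jacobian_ideal f (a * b).
Proof.
move=> [d ->]; exists (fun i => a * d i).
by rewrite big_distrr; apply: eq_bigr => i _; rewrite /= mulrA.
Qed.

Section Tjurina.

Variable f : {mpoly F[3]}.
Local Notation J := (homog_localization (jacobian_ideal f) p).

Let J0 : J 0. Proof. exact: homog_localization0 (jacobian_ideal0 f). Qed.
Let JD x y : J x -> J y -> J (x + y).
Proof. exact: homog_localizationD (@jacobian_idealD f) (@jacobian_idealM f) x y. Qed.
Let JM x y : O x -> J y -> J (x * y).
Proof. exact: homog_localizationM (@jacobian_idealM f) x y. Qed.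

Lemma tjurina_le_size B N : (forall x, O x -> spans cst J B x) ->
  has_tjurina_number f p N -> (N <= size B)%N.
Proof.
move=> spB [e [Oe basis]].
exact: (basis_size_le local_ring_cst J0 JD JM spB Oe basis).
Qed.


Let frhS n : fr (h ^+ n.+1) = fr h * fr (h ^+ n).
Proof. by rewrite exprS (rmorphM fr). Qed.

Let frh0 n : fr (h ^+ n) != 0.
Proof. exact: meval_neq0 (hn_neq0 n). Qed.

Let homog_eq d e (g : {mpoly F[3]}) : g \is d.-homog -> d = e -> g \is e.-homog.
Proof. by move=> gd <-. Qed.

Lemma local_unit m (U : {mpoly F[3]}) : U \is m.-homog ->
  leads O s t 0 (fr U / fr (h ^+ m)) (cst (U.@[p 0] / p 0 k ^+ m)).
Proof.
move=> Um; split; first exact: local_ring_cst.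
by rewrite -hnp; apply: (@local_ring_value m).
Qed.

Lemma local_ring_derive w m (U : {mpoly F[3]}) : U \is m.-homog ->
  O (fr (derive w U) * fr h / fr (h ^+ m)).
Proof.
move=> Um; rewrite -(rmorphM fr); apply: (@local_ringP m) => //.
exact: derive_mul_homog.
Qed.

Let point_neq0 n : p 0 k ^+ n != 0.
Proof. by rewrite expf_neq0. Qed.

Lemma tjurina_double n1 n2 m (f1 f2 U : {mpoly F[3]}) N : f = f1 * (f2 * U) ->
  gradient f1 p = g1 -> gradient f2 p = g2 ->
  f1 \is n1.+1.-homog -> f2 \is n2.+1.-homog -> U \is m.-homog ->
  f1.@[p 0] = 0 -> f2.@[p 0] = 0 -> U.@[p 0] != 0 ->
  has_tjurina_number f p N -> (N <= 1)%N.
Proof.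
move=> fE f1g f2g f1h f2h Uh f1p f2p U0.
have fn : f \is (1 + (n1 + (n2 + m))).+1.-homog.
  rewrite fE; apply: homog_eq (dhomogM f1h (dhomogM f2h Uh)) _; clear; lia.
(* The homogeneous factors are differentiated first and divided by powers of [h] afterwards, so no
   derivative of a denominator occurs. *)
have Jw w : J (fr (derive w f1) / fr (h ^+ n1) *
     (fr f2 / fr (h ^+ n2.+1) * (fr U / fr (h ^+ m))) +
   fr f1 / fr (h ^+ n1.+1) * (fr (derive w f2) / fr (h ^+ n2) * (fr U / fr (h ^+ m)) +
     fr f2 / fr (h ^+ n2.+1) * (fr (derive w U) * fr h / fr (h ^+ m)))).
  rewrite !frhS (quotient_leibniz2 _ _ _ _ _ _ h0 (frh0 n1) (frh0 n2) (frh0 m)).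
  have := derive_quotient_in w fn.
  by rewrite {2}fE !deriveM !exprD expr1 !(rmorphD fr, rmorphM fr).
have := branch_at f1h f1p; rewrite f1g g1w1 g1w2 mul0r => b1.
have := branch_at f2h f2p; rewrite f2g g2w1 g2w2 mul0r => b2.
apply: (@tjurina_le_size [:: 1]).
apply: (spans_branches2 OD OM local_ring_cst Os Ot O_value O_unit J0 JD JM b1 b2
  (local_unit Uh) (local_ring_derive w1 Uh) (local_ring_derive w2 Uh) _ _ _ (Jw w1) (Jw w2)).
- by rewrite mul1r invr_eq0.
- by rewrite mul1r invr_eq0.
- by rewrite mulf_neq0 // invr_eq0.
Qed.

Hypotheses (two_neq0 : 2%:R != 0 :> F) (three_neq0 : 3%:R != 0 :> F).

Let cross_dot1 q : cross q g2 != 0 -> dot q p = 0 -> dot q w1 != 0.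
Proof.
move=> c0 qp; apply: contraNneq c0 => q1; rewrite cross_perp // g2w1 g2w2 q1.
by rewrite mul0r mulr0 subrr scale0r.
Qed.

Let cross_dot2 q : cross q g1 != 0 -> dot q p = 0 -> dot q w2 != 0.
Proof.
move=> c0 qp; apply: contraNneq c0 => q2; rewrite cross_perp // g1w1 g1w2 q2.
by rewrite mul0r mulr0 subrr scale0r.
Qed.

Lemma tjurina_triple n1 n2 n3 m (f1 f2 f3 U : {mpoly F[3]}) N :
  f = f1 * (f2 * (f3 * U)) ->
  gradient f1 p = g1 -> gradient f2 p = g2 ->
  f1 \is n1.+1.-homog -> f2 \is n2.+1.-homog -> f3 \is n3.+1.-homog ->
  U \is m.-homog ->
  f1.@[p 0] = 0 -> f2.@[p 0] = 0 -> f3.@[p 0] = 0 -> U.@[p 0] != 0 ->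
  cross (gradient f3 p) g1 != 0 -> cross (gradient f3 p) g2 != 0 ->
  has_tjurina_number f p N -> (N <= 4)%N.
Proof.
move=> fE f1g f2g f1h f2h f3h Uh f1p f2p f3p U0 c31 c32.
have fn : f \is (2 + (n1 + (n2 + (n3 + m)))).+1.-homog.
  have h3 := dhomogM f3h Uh; have h2 := dhomogM f2h h3; have h1' := dhomogM f1h h2.
  rewrite fE.
  apply: homog_eq h1' _.
  by clear; lia.
have f3g : dot (gradient f3 p) p = 0 by rewrite (dot_gradient _ f3h) f3p mulr0.
have Jw w : J (fr (derive w f1) / fr (h ^+ n1) *
    (fr f2 / fr (h ^+ n2.+1) * (fr f3 / fr (h ^+ n3.+1) * (fr U / fr (h ^+ m)))) +
   fr f1 / fr (h ^+ n1.+1) *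
    (fr (derive w f2) / fr (h ^+ n2) * (fr f3 / fr (h ^+ n3.+1) * (fr U / fr (h ^+ m))) +
     fr f2 / fr (h ^+ n2.+1) * (fr (derive w f3) / fr (h ^+ n3) * (fr U / fr (h ^+ m)) +
       fr f3 / fr (h ^+ n3.+1) * (fr (derive w U) * fr h / fr (h ^+ m))))).
  rewrite !frhS (quotient_leibniz3 _ _ _ _ _ _ _ _ h0 (frh0 n1) (frh0 n2) (frh0 n3) (frh0 m)).
  have := derive_quotient_in w fn.
  by rewrite {2}fE !deriveM !exprD !(rmorphD fr, rmorphXn fr, rmorphM fr).
have := branch_at f1h f1p; rewrite f1g g1w1 g1w2 mul0r => b1.
have := branch_at f2h f2p; rewrite f2g g2w1 g2w2 mul0r => b2.
apply: (@tjurina_le_size [:: 1; s; t; s * t]).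
apply: (spans_branches3 OD OM local_ring_cst Os Ot O_value O_unit J0 JD JM three_neq0
  b1 b2 (branch_at f3h f3p)
  (local_unit Uh) (local_ring_derive w1 Uh) (local_ring_derive w2 Uh)
  _ _ _ _ _ (Jw w1) (Jw w2)).
- by rewrite mul1r invr_eq0.
- by rewrite mul1r invr_eq0.
- by rewrite mulf_neq0 ?invr_eq0 // cross_dot1.
- by rewrite mulf_neq0 ?invr_eq0 // cross_dot2.
- by rewrite mulf_neq0 // invr_eq0.
Qed.

Lemma tjurina_quadruple n1 n2 n3 n4 m (f1 f2 f3 f4 U : {mpoly F[3]}) N :
  f = f1 * (f2 * (f3 * (f4 * U))) ->
  gradient f1 p = g1 -> gradient f2 p = g2 ->
  f1 \is n1.+1.-homog -> f2 \is n2.+1.-homog -> f3 \is n3.+1.-homog ->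
  f4 \is n4.+1.-homog -> U \is m.-homog ->
  f1.@[p 0] = 0 -> f2.@[p 0] = 0 -> f3.@[p 0] = 0 -> f4.@[p 0] = 0 ->
  U.@[p 0] != 0 ->
  cross (gradient f3 p) g1 != 0 -> cross (gradient f3 p) g2 != 0 ->
  cross (gradient f4 p) g1 != 0 -> cross (gradient f4 p) g2 != 0 ->
  cross (gradient f3 p) (gradient f4 p) != 0 ->
  has_tjurina_number f p N -> (N <= 9)%N.
Proof.
move=> fE f1g f2g f1h f2h f3h f4h Uh f1p f2p f3p f4p U0 c31 c32 c41 c42 c34.
have fn : f \is (3 + (n1 + (n2 + (n3 + (n4 + m))))).+1.-homog.
  have h4 := dhomogM f4h Uh; have h3 := dhomogM f3h h4.
  have h2 := dhomogM f2h h3; have h1' := dhomogM f1h h2.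
  rewrite fE.
  apply: homog_eq h1' _.
  by clear; lia.
have f3g : dot (gradient f3 p) p = 0 by rewrite (dot_gradient _ f3h) f3p mulr0.
have f4g : dot (gradient f4 p) p = 0 by rewrite (dot_gradient _ f4h) f4p mulr0.
have Jw w : J (fr (derive w f1) / fr (h ^+ n1) *
    (fr f2 / fr (h ^+ n2.+1) *
      (fr f3 / fr (h ^+ n3.+1) * (fr f4 / fr (h ^+ n4.+1) * (fr U / fr (h ^+ m))))) +
   fr f1 / fr (h ^+ n1.+1) *
    (fr (derive w f2) / fr (h ^+ n2) *
      (fr f3 / fr (h ^+ n3.+1) * (fr f4 / fr (h ^+ n4.+1) * (fr U / fr (h ^+ m)))) +
     fr f2 / fr (h ^+ n2.+1) *
      (fr (derive w f3) / fr (h ^+ n3) * (fr f4 / fr (h ^+ n4.+1) * (fr U / fr (h ^+ m))) +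
       fr f3 / fr (h ^+ n3.+1) *
        (fr (derive w f4) / fr (h ^+ n4) * (fr U / fr (h ^+ m)) +
         fr f4 / fr (h ^+ n4.+1) * (fr (derive w U) * fr h / fr (h ^+ m)))))).
  rewrite !frhS (quotient_leibniz4 _ _ _ _ _ _ _ _ _ _
    h0 (frh0 n1) (frh0 n2) (frh0 n3) (frh0 n4) (frh0 m)).
  have := derive_quotient_in w fn.
  by rewrite {2}fE !deriveM !exprD !(rmorphD fr, rmorphXn fr, rmorphM fr).
have := branch_at f1h f1p; rewrite f1g g1w1 g1w2 mul0r => b1.
have := branch_at f2h f2p; rewrite f2g g2w1 g2w2 mul0r => b2.
apply: (@tjurina_le_size [:: 1; s; t; s ^+ 2; s * t; t ^+ 2; s ^+ 2 * t; s * t ^+ 2;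
              s ^+ 2 * t ^+ 2]).
apply: (spans_branches4 OD OM local_ring_cst Os Ot O_value O_unit J0 JD JM two_neq0
  b1 b2 (branch_at f3h f3p) (branch_at f4h f4p)
  (local_unit Uh) (local_ring_derive w1 Uh) (local_ring_derive w2 Uh)
  _ _ _ _ _ _ _ _ (Jw w1) (Jw w2)).
- by rewrite mul1r invr_eq0.
- by rewrite mul1r invr_eq0.
- by rewrite mulf_neq0 ?invr_eq0 // cross_dot1.
- by rewrite mulf_neq0 ?invr_eq0 // cross_dot2.
- by rewrite mulf_neq0 ?invr_eq0 // cross_dot1.
- by rewrite mulf_neq0 ?invr_eq0 // cross_dot2.
- rewrite mulf_div mulf_div [p 0 k ^+ n4 * _]mulrC -mulrBl mulf_neq0 ?invr_eq0 //.
    move: c34; rewrite cross_perp // scaler_eq0 negb_or => /andP[+ _].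
    by rewrite [dot (gradient f3 p) w2 * _]mulrC.
  by rewrite mulf_neq0.
- by rewrite mulf_neq0 // invr_eq0.
Qed.

End Tjurina.
End LocalRing.
End Homogeneous.

(** * Tjurina numbers of ordinary points *)

Section OrdinaryPoints.

Variable F : fieldType.
Implicit Types (f : {mpoly F[3]}) (p : 'rV[F]_3).

Lemma proportional_cross (u v : 'rV[F]_3) :
  u != 0 -> v != 0 -> ~ proportional u v -> cross u v != 0.
Proof.
move=> u0 v0 uv; apply/eqP => c0; apply: uv.
have [|c vE] := @cross_eq0 _ v u u0; first by rewrite crossC c0 oppr0.
by exists c => //; apply: contraNneq v0 => c0'; rewrite vE c0' scale0r.
Qed.

Lemma gradientM f g p :
  gradient (f * g) p = g.@[p 0] *: gradient f p + f.@[p 0] *: gradient g p.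
Proof. by apply/rowP => i; rewrite !mxE mderivM mevalD !mevalM mulrC. Qed.

Lemma gradient_linear_form w p : gradient (linear_form w) p = w.
Proof. by apply/rowP => i; rewrite mxE mderiv_linear_form mevalC. Qed.

Lemma member_homog f : is_line f \/ is_smooth_conic f ->
  exists n, f \is n.+1.-homog.
Proof. by case=> [[_ f1]|[_ f2 _]]; [exists 0%N | exists 1%N]. Qed.

Lemma member_smooth f p : is_line f \/ is_smooth_conic f ->
  p != 0 -> f.@[p 0] = 0 -> gradient f p != 0.
Proof.
move=> mf p0 fp; apply/eqP => gp; case: mf => [[f0 /linear_formE]|[_ _ /(_ p)]].
  set w := \row_k _ => fE.
  have w0 : w = 0 by rewrite -(gradient_linear_form w p) -fE.
  by move: f0; rewrite fE w0 -[X in linear_form X](scale0r 0) linear_formZ scale0r eqxx.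
by apply; split.
Qed.

Variables (I : finType) (C : I -> {mpoly F[3]}).
Hypothesis C_member : forall i, is_line (C i) \/ is_smooth_conic (C i).

Lemma prod_homog (P : pred I) : exists m, \prod_(i | P i) C i \is m.-homog.
Proof.
elim/big_ind: _ => [|f g [m fm] [n gn]|i _]; first by exists 0%N; apply: dhomog1.
  by exists (m + n)%N; apply: dhomogM.
by have [n Cn] := member_homog (C_member i); exists n.+1.
Qed.

Definition curves_at p : {set I} := [set i | (C i).@[p 0] == 0].

(** The product over a list permits a case analysis on the number of curves through [p]; the
    cofactor [U] becomes a unit at [p]. *)
Lemma union_curve_split p : exists U m,
  [/\ union_curve C = (\prod_(i <- enum (curves_at p)) C i) * U,
      U \is m.-homog & U.@[p 0] != 0].
Proof.
have [m Um] := prod_homog [pred i | i \notin curves_at p].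
exists (\prod_(i | i \notin curves_at p) C i), m; split=> //.
  by rewrite big_enum /= /union_curve (bigID (mem (curves_at p))).
rewrite rmorph_prod; apply/prodf_neq0 => i; by rewrite inE.
Qed.

(** With no curve through [p] the union does not pass through [p]; with just one, its gradient is a
    nonzero multiple of that of a smooth member. *)
Lemma ordinary_point_gt1 r p : ordinary_point C r p -> (1 < r)%N.
Proof.
move=> [[p0 up gp] <- _]; have [U [m [uE _ U0]]] := union_curve_split p.
rewrite ltnNge; apply/negP; rewrite -/(curves_at p) cardE; move: uE.
have : forall i, i \in enum (curves_at p) -> (C i).@[p 0] = 0.
  by move=> i; rewrite mem_enum inE => /eqP.
case: (enum _) => [_|i [|//] Ci]; rewrite ?big_nil ?big_seq1 => uE _.
  by move/eqP: up; rewrite uE mul1r (negPf U0).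
move/eqP: gp; rewrite uE gradientM Ci ?mem_head // scale0r addr0 scaler_eq0 (negPf U0).
by apply/negP; apply: member_smooth (C_member i) p0 (Ci i (mem_head _ _)).
Qed.

Hypotheses (two_neq0 : 2%:R != 0 :> F) (three_neq0 : 3%:R != 0 :> F).

Theorem tjurina_ordinary r p N : ordinary_point C r p -> (r <= 4)%N ->
  has_tjurina_number (union_curve C) p N -> (N <= r.-1 ^ 2)%N.
Proof.
move=> ord_p r4; have r1 := ordinary_point_gt1 ord_p.
case: ord_p r1 r4 => [[p0 up gp] <- transv].
rewrite -/(curves_at p) cardE.
have [U [m [uE Um U0]]] := union_curve_split p.
have Cp i : i \in enum (curves_at p) -> (C i).@[p 0] = 0.
  by rewrite mem_enum inE => /eqP.
have cr i j : i \in enum (curves_at p) -> j \in enum (curves_at p) -> i != j ->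
    cross (gradient (C i) p) (gradient (C j) p) != 0.
  move=> /Cp iV /Cp jV ij; apply: proportional_cross; last exact: transv.
    exact: member_smooth.
  exact: member_smooth.
have [k pk] : exists k, p 0 k != 0 by apply/rV0Pn.
have perp i : i \in enum (curves_at p) -> dot (gradient (C i) p) p = 0.
  move=> /Cp ip; have [n Cn] := member_homog (C_member i).
  by rewrite (dot_gradient _ Cn) ip mulr0.
move: (enum_uniq (curves_at p)) uE Cp cr perp {transv up gp}.
case: (enum _) => [|i [|j s]] //= /andP[ijs js_uniq] uE Cp cr perp _ s4.
have iV : i \in i :: j :: s by rewrite mem_head.
have jV : j \in i :: j :: s by rewrite !in_cons eqxx orbT.
have ij : i != j by apply: contraNneq ijs => ->; rewrite mem_head.
have [w1 [w2 [w3 [d11 d12 d21 d22 dec]]]] :=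
  frame pk (perp i iV) (perp j jV) (cr i j iV jV ij).
have [ni Ci] := member_homog (C_member i).
have [nj Cj] := member_homog (C_member j).
case: s s4 ijs js_uniq uE Cp cr perp iV jV => [|x [|y [|//]]] _ ijs js uE Cp cr perp iV jV.
- apply: (tjurina_double pk (perp i iV) (perp j jV) d11 d12 d21 d22 dec _ erefl erefl
    Ci Cj Um (Cp i iV) (Cp j jV) U0).
  by rewrite uE !big_cons big_nil mulr1 -!mulrA.
- have xV : x \in [:: i; j; x] by rewrite !inE eqxx !orbT.
  have [nx Cx] := member_homog (C_member x).
  move: ijs js; rewrite !inE !negb_or => /andP[_ ix] /andP[jx _].
  apply: (tjurina_triple pk (perp i iV) (perp j jV) d11 d12 d21 d22 dec three_neq0
    _ erefl erefl Ci Cj Cx Um (Cp i iV) (Cp j jV) (Cp x xV) U0).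
  + by rewrite uE !big_cons big_nil mulr1 -!mulrA.
  + by apply: cr; rewrite // eq_sym.
  + by apply: cr; rewrite // eq_sym.
- have xV : x \in [:: i; j; x; y] by rewrite !inE eqxx !orbT.
  have yV : y \in [:: i; j; x; y] by rewrite !inE eqxx !orbT.
  have [nx Cx] := member_homog (C_member x).
  have [ny Cy] := member_homog (C_member y).
  move: ijs js; rewrite !inE !negb_or => /and3P[_ ix iy] /andP[/andP[jx jy] /andP[xy _]].
  apply: (tjurina_quadruple pk (perp i iV) (perp j jV) d11 d12 d21 d22 dec two_neq0
    _ erefl erefl Ci Cj Cx Cy Um (Cp i iV) (Cp j jV) (Cp x xV) (Cp y yV) U0).
  + by rewrite uE !big_cons big_nil mulr1 -!mulrA.
  + by apply: cr; rewrite // eq_sym.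
  + by apply: cr; rewrite // eq_sym.
  + by apply: cr; rewrite // eq_sym.
  + by apply: cr; rewrite // eq_sym.
  + by apply: cr; rewrite -?mem_seq1.
Qed.

End OrdinaryPoints.

(** * Intersections of the curves *)

Section Intersections.

Variable F : fieldType.
Implicit Types (f : {mpoly F[3]}) (p u v w : 'rV[F]_3).

Lemma in_plane u v w : cross u v != 0 -> dot w (cross u v) = 0 ->
  exists a b, w = a *: u + b *: v.
Proof.
move=> n0 wn; have [k nk] : exists k, cross u v 0 k != 0 by apply/rV0Pn.
have [w1 [w2 [w3 [_ _ _ _ dec]]]] := frame nk (dot_crossl u v) (dot_crossr u v) n0.
exists (dot w w1), (dot w w2).
exact: (perp_decomp nk (dot_crossl u v) (dot_crossr u v) dec wn).
Qed.

(** This is the polar form of the conic, given by its Hessian matrix, which is symmetric because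
    partial derivatives commute. *)
Lemma conic_polar_sym f u v : f \is 2.-homog ->
  dot (gradient f u) v = dot (gradient f v) u.
Proof.
move=> f2; have fk k := linear_formE (mderiv_homog k f2).
pose h k : 'rV_3 := \row_l (f^`M(k))@_U_(l).
have hC k l : h k 0 l = h l 0 k.
  apply/eqP; rewrite -(mpolyC_eq 3); apply/eqP.
  by rewrite -!mderiv_linear_form -!fk mderiv_comm.
have gE w : gradient f w = \row_k dot (h k) w.
  by apply/rowP => k; rewrite !mxE fk meval_linear_form.
rewrite !gE !dotE !mxE !dotE (hC o1 o0) (hC o2 o0) (hC o2 o1); ring.
Qed.

Lemma conic_polarD f u v w : f \is 2.-homog ->
  dot (gradient f (u + v)) w = dot (gradient f u) w + dot (gradient f v) w.
Proof. by move=> f2; rewrite !(conic_polar_sym _ w) // dotDr. Qed.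

Lemma conic_polarZ f c u w : f \is 2.-homog ->
  dot (gradient f (c *: u)) w = c * dot (gradient f u) w.
Proof. by move=> f2; rewrite !(conic_polar_sym _ w) // dotZr. Qed.

(* A conic through three points of a line contains the line, so it is tangent
   to it everywhere. *)
Lemma three_points_tangent f w u v z :
  2%:R != 0 :> F -> f \is 2.-homog ->
  dot w u = 0 -> dot w v = 0 -> dot w z = 0 ->
  w != 0 -> cross u v != 0 -> cross u z != 0 -> cross v z != 0 ->
  f.@[u 0] = 0 -> f.@[v 0] = 0 -> f.@[z 0] = 0 -> cross (gradient f u) w = 0.
Proof.
move=> F2 f2 wu wv wz w0 uv uz vz fu fv fz.
have fD (q : 'rV[F]_3) : f.@[q 0] = 0 -> dot (gradient f q) q = 0.
  by move=> fq; rewrite (dot_gradient _ f2) fq mulr0.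
have [x wx] : exists x, w = x *: cross u v.
  by apply: orthogonal_cross; rewrite // dotC.
have x0 : x != 0 by apply: contraNneq w0 => x0; rewrite wx x0 scale0r.
have [a [b zE]] : exists a b, z = a *: u + b *: v.
  apply: in_plane => //; apply: (mulfI x0).
  by rewrite -dotZr -wx dotC wz mulr0.
have a0 : a != 0.
  apply: contraNneq vz => a0; rewrite zE a0 scale0r add0r; apply/eqP/rowP.
  by apply: ord3P; rewrite !mxE /=; ring.
have b0 : b != 0.
  apply: contraNneq uz => b0; rewrite zE b0 scale0r addr0; apply/eqP/rowP.
  by apply: ord3P; rewrite !mxE /=; ring.
(* In the expansion of the quadratic form at [z = a u + b v] only the mixed term survives. *)
have guv : dot (gradient f u) v = 0.
  have := fD z fz; rewrite zE conic_polarD // !conic_polarZ // !dotDr !dotZr.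
  rewrite !fD // (conic_polar_sym v u f2).
  have -> : a * (a * 0 + b * dot (gradient f u) v) + b * (a * dot (gradient f u) v + b * 0)
    = 2%:R * (a * b) * dot (gradient f u) v by ring.
  by move/eqP; rewrite !mulf_eq0 (negPf F2) (negPf a0) (negPf b0) /= => /eqP.
have [||y gy] := @orthogonal_cross _ u v (gradient f u) uv.
- by rewrite dotC fD.
- by rewrite dotC.
by rewrite gy wx; apply/rowP; apply: ord3P; rewrite !mxE /=; ring.
Qed.

Variables (I : finType) (C : I -> {mpoly F[3]}).

Lemma two_curves_singular i j p : i != j -> p != 0 ->
  (C i).@[p 0] = 0 -> (C j).@[p 0] = 0 -> singular_point (union_curve C) p.
Proof.
move=> ij p0 ip jp; rewrite /union_curve (bigD1 i) //= (bigD1 j) 1?eq_sym //=.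
split=> //; first by rewrite mevalM ip mul0r.
by rewrite gradientM mevalM ip jp mul0r !scale0r addr0.
Qed.

End Intersections.

Section Degree.

Variables (F : fieldType) (d : nat) (L : 'I_d -> {mpoly F[3]}) (Q : {mpoly F[3]}).
Hypotheses (L_line : forall i, is_line (L i)) (Q_conic : is_smooth_conic Q).

Lemma union_curve_degree : curve_degree (union_curve (lines_and_conic L Q)) = d.+2.
Proof.
set f := union_curve _.
have f0 : f != 0.
  apply/prodf_neq0 => -[i|] _ /=; first by have [] := L_line i.
  by have [] := Q_conic.
have fd : f \is (\sum_(o : option 'I_d) (1 + (o == None))%N).-homog.
  rewrite /f /union_curve; elim/big_rec2: _ => [|o n g _ gn]; first exact: dhomog1.
  apply: dhomogM gn; case: o => [i|] /=; first by have [] := L_line i.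
  by have [] := Q_conic.
rewrite /curve_degree (dhomog_uniq f0 (dhomog_msize fd) fd) big_split /=.
rewrite sum1_card card_option card_ord (bigD1 None) //= big1 ?addn1 ?addn0 //.
by move=> o /negPf->.
Qed.

End Degree.

(** * The bound on the number of lines *)

Section RealLines.

Variable R : rcfType.
Local Notation toC := (map_mx (real_complex R)).

Lemma cross_toC (u v : 'rV[R]_3) : cross (toC u) (toC v) = toC (cross u v).
Proof.
by apply/rowP; apply: ord3P; rewrite !mxE /= rmorphB !rmorphM.
Qed.

Lemma dot_toC (u v : 'rV[R]_3) : dot (toC u) (toC v) = (dot u v)%:C%C.
Proof. by rewrite !dotE !rmorphD !rmorphM !mxE. Qed.

Lemma toC_eq0 (u : 'rV[R]_3) : (toC u == 0) = (u == 0).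
Proof. exact: map_mx_eq0. Qed.

Lemma real_lineE (f : {mpoly (complex R)[3]}) : is_line f -> is_real_curve f ->
  exists a c, c != 0 /\ f = c *: linear_form (toC a).
Proof.
move=> [_ /linear_formE fE] [g [c c0 fg]].
exists (\row_k g@_U_(k)), c; split=> //; rewrite fE -linear_formZ; congr linear_form.
by apply/rowP => k; rewrite !mxE fg mcoeffZ mcoeff_map_mpoly.
Qed.

End RealLines.

Section Counting.

Variables (R : rcfType) (d : nat).
Variables (L : 'I_d -> {mpoly (complex R)[3]}) (Q : {mpoly (complex R)[3]}).
Local Notation F := (lines_and_conic L Q).
Local Notation toC := (map_mx (real_complex R)).
Hypothesis d_gt4 : (4 < d)%N.
Hypotheses (L_line : forall i, is_line (L i)) (Q_conic : is_smooth_conic Q).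
Hypothesis L_distinct : forall i j, i != j -> ~ proportional (L i) (L j).
Hypothesis F_ordinary : only_ordinary_singularities F 4.

Variables (a : 'I_d -> 'rV[R]_3) (c : 'I_d -> complex R).
Hypotheses (c_neq0 : forall i, c i != 0)
  (LE : forall i, L i = c i *: linear_form (toC (a i))).

Variables (N : nat) (pt : 'I_N -> 'rV[complex R]_3) (tau : 'I_N -> nat).
Hypotheses (pt_sing : forall x, singular_point (union_curve F) (pt x))
  (pt_distinct : forall x y, x != y -> ~ proportional (pt x) (pt y))
  (pt_all : forall q, singular_point (union_curve F) q ->
     exists x, proportional (pt x) q)
  (pt_tau : forall x, has_tjurina_number (union_curve F) (pt x) (tau x)).

Let F_member o : is_line (F o) \/ is_smooth_conic (F o).
Proof. by case: o => [i|]; [left; apply: L_line | right]. Qed.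

Let nat_neq0 n : n.+1%:R != 0 :> complex R.
Proof. by rewrite pnatr_eq0. Qed.

(** [V x] consists of all curves through the [x]-th singular point; [#|W x|] and [q x] are the
    numbers [w] and [e] of its lines and conics. *)
Let V x := curves_at F (pt x).
Let W x : {set 'I_d} := [set i | Some i \in V x].
Let q x : nat := None \in V x.

Let pt_neq0 x : pt x != 0.
Proof. by have [] := pt_sing x. Qed.

Let pt_ordinary x : (#|V x| <= 4)%N /\ ordinary_point F #|V x| (pt x).
Proof.
have [r r4 xr] := F_ordinary (pt_sing x).
by have [_ rV _] := xr; rewrite /V /curves_at rV.
Qed.

Let card_V_gt1 x : (1 < #|V x|)%N.
Proof. exact: (ordinary_point_gt1 F_member (proj2 (pt_ordinary x))). Qed.

Let card_VE x : #|V x| = (#|W x| + q x)%N.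
Proof.
rewrite (cardsD1 None) addnC; congr (_ + _)%N.
rewrite -[RHS](card_imset _ (@Some_inj _)); apply: eq_card => -[i|].
  rewrite !inE /=; apply/idP/imsetP => [iV|[j + [->]]]; last by rewrite !inE.
  by exists i; rewrite ?inE.
rewrite !inE /=; apply/esym/negP => /imsetP[//].
Qed.

Let tau_le x : (tau x <= (#|W x| + q x).-1 ^ 2)%N.
Proof.
rewrite -card_VE; have [V4 Vord] := pt_ordinary x.
exact: (tjurina_ordinary F_member (nat_neq0 1) (nat_neq0 2) Vord V4).
Qed.

Let meval_line i (p : 'rV[complex R]_3) : ((L i).@[p 0] == 0) = (dot (toC (a i)) p == 0).
Proof. by rewrite LE mevalZ meval_linear_form mulf_eq0 (negPf (c_neq0 i)). Qed.

Let memW x i : (i \in W x) = (dot (toC (a i)) (pt x) == 0).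
Proof. by rewrite !inE /= meval_line. Qed.

Let a_neq0 i : a i != 0.
Proof.
have [L0 _] := L_line i; apply: contraNneq L0 => a0.
by rewrite LE a0 (_ : toC 0 = 0 *: 0) ?linear_formZ ?scale0r ?scaler0 // map_mx0.
Qed.

Let a_cross i j : i != j -> cross (a i) (a j) != 0.
Proof.
move=> ij; rewrite -toC_eq0 -cross_toC; apply: proportional_cross; rewrite ?toC_eq0 //.
move=> [e e0 aE]; apply: (L_distinct ij); exists (c j / c i * e).
  by rewrite !mulf_neq0 ?invr_eq0.
rewrite !LE aE linear_formZ !scalerA; congr (_ *: _).
by rewrite mulrAC divfK // mulrC.
Qed.

Let toC_cross i j : i != j -> cross (toC (a i)) (toC (a j)) != 0.
Proof. by move=> ij; rewrite cross_toC toC_eq0 a_cross. Qed.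

Let meet x i j : i != j -> i \in W x -> j \in W x ->
  exists2 e, e != 0 & pt x = e *: cross (toC (a i)) (toC (a j)).
Proof.
move=> ij; rewrite !memW => /eqP ix /eqP jx.
have [e xE] := orthogonal_cross (toC_cross ij) ix jx.
by exists e => //; apply: contraNneq (pt_neq0 x) => e0; rewrite xE e0 scale0r.
Qed.

Let meet_unique x y i j : i != j -> i \in W x -> j \in W x ->
  i \in W y -> j \in W y -> x = y.
Proof.
move=> ij ix jx iy jy; apply/eqP; apply: contraT => /pt_distinct; case.
have [e e0 ->] := meet ij ix jx; have [e' e'0 ->] := meet ij iy jy.
exists (e' / e); first by rewrite mulf_neq0 ?invr_eq0.
by rewrite scalerA divfK.
Qed.

(** An ordered pair of distinct lines has at most one listed point in common. *)
Lemma sum_line_pairs : (\sum_x #|W x| * #|W x|.-1 <= d * d.-1)%N.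
Proof.
have -> : (\sum_x #|W x| * #|W x|.-1 =
    \sum_(i < d) \sum_(j < d | j != i) \sum_x ((i \in W x) && (j \in W x)))%N.
  under [RHS]eq_bigr do rewrite exchange_big.
  rewrite exchange_big; apply: eq_bigr => x _ /=.
  rewrite -sum_nat_const big_mkcond; apply: eq_bigr => i _.
  have [iW|iW] := boolP (i \in W x); last by rewrite big1.
  rewrite (cardsD1 i) iW add1n /= -sum1_card big_mkcond [RHS]big_mkcond.
  by apply: eq_bigr => j _; rewrite !inE; case: (j == i); case: (Some j \in V x).
have -> : (d * d.-1 = \sum_(i < d) \sum_(j < d | j != i) 1)%N.
  under eq_bigr do rewrite sum1_card cardC1 card_ord.
  by rewrite sum_nat_const card_ord.
apply: leq_sum => i _; apply: leq_sum => j ji.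
rewrite -big_mkcond sum1dep_card; apply/card_le1_eqP => x y.
rewrite in_set => /andP[ix jx]; rewrite in_set => /andP[iy jy].
exact: (meet_unique ji jy iy jx ix).
Qed.

(** Three common points of a line and the conic would make them tangent at one of these, which an
    ordinary singularity excludes. *)
Lemma sum_conic_pairs : (\sum_x q x * #|W x| <= 2 * d)%N.
Proof.
have -> : (\sum_x q x * #|W x| =
    \sum_(i < d) \sum_x ((None \in V x) && (i \in W x)))%N.
  rewrite exchange_big; apply: eq_bigr => x _.
  rewrite -sum1_card big_distrr big_mkcond /=; apply: eq_bigr => i _.
  by rewrite /q; case: (None \in V x); case: (i \in W x).
rewrite mulnC -[X in (_ <= X * 2)%N]card_ord -sum_nat_const.
apply: leq_sum => i _; rewrite -big_mkcond sum1dep_card leqNgt; apply/negP.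
move=> /card_gt2P[x [y [z [[xi yi zi] [xy yz zx]]]]].
have vanish x' : x' \in [set x | (None \in V x) && (i \in W x)] ->
    [/\ Q.@[pt x' 0] = 0, (L i).@[pt x' 0] = 0 & dot (toC (a i)) (pt x') = 0].
  rewrite in_set => /andP[Qx]; rewrite memW => ix; split; last exact/eqP.
    by move: Qx; rewrite in_set => /eqP.
  by apply/eqP; rewrite meval_line.
have [Qx ix ax] := vanish x xi.
have [Qy _ ay] := vanish y yi.
have [Qz _ az] := vanish z zi.
have pc x' y' : x' != y' -> cross (pt x') (pt y') != 0.
  by move=> xy'; apply: proportional_cross; rewrite ?pt_neq0 //; apply: pt_distinct.
have [_ Q2 _] := Q_conic.
have ai0 : toC (a i) != 0 by rewrite toC_eq0.
have xz : x != z by rewrite eq_sym.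
have c0 := three_points_tangent (nat_neq0 1) Q2 ax ay az ai0 (pc _ _ xy) (pc _ _ xz)
  (pc _ _ yz) Qx Qy Qz.
have [_ _ /(_ None (Some i) isT Qx ix)] := proj2 (pt_ordinary x).
have gQ : gradient Q (pt x) != 0 by apply: (member_smooth (F_member None)).
have gL : gradient (L i) (pt x) != 0 by apply: (member_smooth (F_member (Some i))).
move=> /(proportional_cross gQ gL); rewrite LE -linear_formZ gradient_linear_form.
by rewrite crossZr c0 scaler0 eqxx.
Qed.

(** A common zero of all the forms would be a singular point on [d > 4] lines. *)
Let a_rank w : (forall j, dot (a j) w = 0) -> w = 0.
Proof.
move=> aw; apply/eqP; apply: contraT => w0.
have Lw i : (L i).@[toC w 0] = 0.
  by apply/eqP; rewrite meval_line dot_toC aw.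
have lt0 : (0 < d)%N by apply: leq_trans d_gt4.
have lt1 : (1 < d)%N by apply: leq_trans d_gt4.
have w_sing : singular_point (union_curve F) (toC w).
  apply: (@two_curves_singular _ _ _ (Some (Ordinal lt0)) (Some (Ordinal lt1))).
  - by [].
  - by rewrite toC_eq0.
  - exact: Lw.
  - exact: Lw.
have [r r4 [_ rE _]] := F_ordinary w_sing.
suff : (d <= r)%N by rewrite leqNgt (leq_ltn_trans r4).
rewrite -rE -[d in (d <= _)%N]card_ord -cardsT -(card_imset _ (@Some_inj _)).
by apply/subset_leq_card/subsetP => o /imsetP[i _ ->]; rewrite inE /= Lw.
Qed.

(** Two real lines meet in a point that is real up to a scalar, so [W] identifies the listed points
    on at least two lines with the flats of a real arrangement. *)
Lemma real_points_melchior :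
  (\sum_(x | 1 < #|W x|) #|W x| + 3 <= 3 * #|[set x | (1 < #|W x|)%N]|)%N.
Proof.
have flatW x i j : i != j -> i \in W x -> j \in W x -> W x = flat a i j.
  move=> ij ix jx; have [e e0 xE] := meet ij ix jx.
  apply/setP => k; rewrite memW inE xE dotZr mulf_eq0 (negPf e0) /=.
  by rewrite cross_toC dot_toC (fmorph_eq0 (real_complex R)).
pose X := [set x | (1 < #|W x|)%N].
have W_inj : {in X &, injective W}.
  move=> x y; rewrite inE => /card_gt1P[i [j [ix jx ij]]] _ Wxy.
  have iy : i \in W y by rewrite -Wxy.
  have jy : j \in W y by rewrite -Wxy.
  exact: (meet_unique ij ix jx iy jy).
have flatsE : flats a = W @: X.
  apply/setP => S; apply/idP/imsetP => [|[x]].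
    case/imsetP=> -[i j] /= ij ->.
    have n_sing : singular_point (union_curve F) (cross (toC (a i)) (toC (a j))).
      apply: (@two_curves_singular _ _ _ (Some i) (Some j)) => /=.
      - exact: ij.
      - exact: toC_cross.
      - by apply/eqP; rewrite meval_line dot_crossl.
      - by apply/eqP; rewrite meval_line dot_crossr.
    have [x [e e0 nE]] := pt_all n_sing.
    have xW k : k \in W x = (dot (toC (a k)) (cross (toC (a i)) (toC (a j))) == 0).
      by rewrite memW nE dotZr mulf_eq0 (negPf e0).
    have ix : i \in W x by rewrite xW dot_crossl.
    have jx : j \in W x by rewrite xW dot_crossr.
    exists x; last by rewrite (flatW x i j).
    by rewrite inE; apply/card_gt1P; exists i, j.
  rewrite inE => /card_gt1P[i [j [ix jx ij]]] ->.
  by rewrite (flatW x i j) // flat_in_flats.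
have := melchior a_cross a_rank (ltn_trans _ d_gt4).
rewrite flatsE card_in_imset // big_imset //= => /(_ isT).
by rewrite (eq_bigl (fun x => (1 < #|W x|)%N)) // => x; rewrite inE.
Qed.

(* The weights 7, 9, 5, 11, 3 make the first inequality an equality exactly off
   the conic, at double and quadruple points, and at the quadruple points of the
   conic. The third says that the contribution [e w] of the remaining points of
   the conic is at most twice the gap in the first. *)
Let local_count w e : (e <= 1)%N -> (1 < w + e <= 4)%N ->
  [/\ 7 * (w + e).-1 ^ 2 + 9 * (1 < w) <=
        5 * (w * w.-1) + 11 * (e * w) + 3 * ((1 < w) * w),
      3 * ((e == 1) && (w == 3)) <= e * w
    & e * w + 14 * (w + e).-1 ^ 2 + 18 * (1 < w) <=
      3 * ((e == 1) && (w == 3)) + 10 * (w * w.-1) + 22 * (e * w) +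
        6 * ((1 < w) * w)]%N.
Proof. by case: e => [|[|//]] _; case: w => [|[|[|[|[|w]]]]]. Qed.

Theorem parity_bound : (\sum_x tau x)%N = M_degree d.+2 ->
  (forall l, d = (2 * l)%N -> (l <= 9)%N) /\
  (forall l, d = (2 * l + 1)%N -> (l <= 10)%N).
Proof.
move=> tauE.
pose sum (f : nat -> nat -> nat) := (\sum_x f #|W x| (q x))%N.
have sumD f g : (sum (fun w e => f w e + g w e) = sum f + sum g)%N by exact: big_split.
have sumM k f : (sum (fun w e => k * f w e) = k * sum f)%N by rewrite /sum big_distrr.
have sum_le f g :
    (forall w e, (e <= 1)%N -> (1 < w + e <= 4)%N -> f w e <= g w e)%N ->
    (sum f <= sum g)%N.
  move=> fg; apply: leq_sum => x _; apply: fg; first exact: leq_b1.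
  by rewrite -card_VE card_V_gt1; case: (pt_ordinary x).
pose S2 := sum (fun w _ => w * w.-1)%N.
pose SK := sum (fun w e => e * w)%N.
pose ST := sum (fun w e => (w + e).-1 ^ 2)%N.
pose SM := sum (fun w _ => (1 < w) * w)%N.
pose Sn := sum (fun w _ => 1 < w)%N.
pose SQ := sum (fun w e => (e == 1) && (w == 3))%N.
have h1 : (7 * ST + 9 * Sn <= 5 * S2 + 11 * SK + 3 * SM)%N.
  by rewrite -!sumM -!sumD; apply: sum_le => w e e1 we; have [] := local_count e1 we.
have h2 : (3 * SQ <= SK)%N.
  by rewrite -!sumM; apply: sum_le => w e e1 we; have [] := local_count e1 we.
have h3 : (SK + 14 * ST + 18 * Sn <= 3 * SQ + 10 * S2 + 22 * SK + 6 * SM)%N.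
  by rewrite -!sumM -!sumD; apply: sum_le => w e e1 we; have [] := local_count e1 we.
have hT : (M_degree d.+2 <= ST)%N by rewrite -tauE; apply: leq_sum => x _; apply: tau_le.
have hL : (S2 <= d * d.-1)%N := sum_line_pairs.
have hK : (SK <= 2 * d)%N := sum_conic_pairs.
have hM : (SM + 3 <= 3 * Sn)%N.
  have := real_points_melchior; rewrite -sum1dep_card !(big_mkcond (fun x => 1 < _)%N).
  rewrite (_ : SM = \sum_x if (1 < #|W x|)%N then #|W x| else 0%N).
    by rewrite (_ : Sn = \sum_x if (1 < #|W x|)%N then 1%N else 0%N).
  by apply: eq_bigr => x _; case: ifP; rewrite ?mul1n.
move: (S2) (SK) (ST) (SM) (Sn) (SQ) h1 h2 h3 hT hL hK hM; rewrite /M_degree.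
clear; move=> S2 SK ST SM Sn SQ h1 h2 h3 hT hL hK hM; split=> l dl.
  have dd : (d.+2)./2 = l.+1 by lia.
  have od : odd d.+2 = false by lia.
  (* The combination of [h1] with 7 times [hT], 5 times [hL], 11 times [hK] and 3 times [hM] is
     [(l - 3) (l - 10) <= 0]. For [l = 10] all these are equalities, and [h2], [h3] give
     [3 * SQ = SK = 40]. *)
  rewrite dl in hL hK; rewrite od dd in hT; nia.
have dd : (d.+2)./2 = l.+1 by lia.
have od : odd d.+2 = true by lia.
(* The same combination now reads [l^2 - 12 l + 15 <= 0], which fails from [l = 11] on. *)
rewrite dl in hL hK; rewrite od dd in hT; nia.
Qed.

End Counting.

Theorem theorem5p1 (R : realType) (d : nat)
    (L : 'I_d -> mpoly.mpoly 3 (complex R)) (Q : mpoly.mpoly 3 (complex R))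
    (d_ge3 : (3 <= d)%N)
    (L_lines : forall i, is_line (L i))
    (Q_conic : is_smooth_conic Q)
    (CL_real : is_real_arrangement (lines_and_conic L Q))
    (CL_M : is_M_arrangement (lines_and_conic L Q))
    (CL_ordinary : only_ordinary_singularities (lines_and_conic L Q) 4) :
  ((forall l : nat, d = (2 * l)%N -> (l <= 9)%N) /\
   ~ (~~ odd d /\ (20 <= d)%N)) /\
  ((forall l : nat, d = (2 * l + 1)%N -> (l <= 10)%N) /\
   ~ (odd d /\ (23 <= d)%N)).
Proof.
(* Up to four lines satisfy the bounds trivially; beyond four, the lines cannot all be concurrent,
   as Melchior's inequality requires. *)
have [d_le4|d_gt4] := leqP d 4.
  split; split; first [by move=> l dl; lia | by case=> _ ?; lia].
have [[_ distinct] _ _ _] := CL_M.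
rewrite union_curve_degree // => -[N [pt [tau [pt_sing pt_distinct pt_all pt_tau tauE]]]].
have [a aP] := choice (fun i => real_lineE (L_lines i) (CL_real (Some i))).
have [c cP] := choice aP.
have L_distinct i j : i != j -> ~ proportional (L i) (L j).
  by move=> ij; apply: (distinct (Some i) (Some j)).
have [even_bound odd_bound] := parity_bound d_gt4 L_lines Q_conic L_distinct CL_ordinary
  (fun i => proj1 (cP i)) (fun i => proj2 (cP i)) pt_sing pt_distinct pt_all pt_tau
  (esym tauE).
split; split=> //.
  case=> d_even d20; have := even_bound d./2; lia.
case=> d_odd d23; have := odd_bound d./2; lia.
Qed.
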